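(* For all $n,k\geqslant1$, all extensions of the modal logic $\mathbf{K4B}_{n}\oplus\{\mathsf{Wid}_{1}^{+},\mathsf{Wid}_{k}^{\bullet}\}$ are finitely axiomatizable, and are hence decidable.
   Context: Modal formulas are built from (countably many) propositional variables with truth-functional operators and $\Box$ (with $\Diamond=\lnot\Box\lnot$). A (normal) modal logic is a set of modal formulas containing all truth-functional tautologies and $\Box(p\to q)\to(\Box p\to\Box q)$, closed under modus ponens, substitution and necessitation. $\mathbf{K}$ is the smallest modal logic; $\mathbf{K4}$ is the smallest modal logic containing $\Box p\to\Box\Box p$. An extension of a modal logic $\mathbf{L}$ is a modal logic $\mathbf{L}'\supseteq\mathbf{L}$. For a set $\Delta$ of formulas, $\mathbf{L}\oplus\Delta$ is the smallest modal logic including $\mathbf{L}\cup\Delta$. A modal logic is finitely axiomatizable if it equals $\mathbf{K}\oplus\Delta$ for some finite $\Delta$. A modal logic is decidable if it is a decidable set of formulas. Formulas: $\mathsf{B}_{1}=\Diamond\Box p_{1}\to p_{1}$ and $\mathsf{B}_{i+1}=\Diamond(\Box p_{i+1}\wedge\lnot\mathsf{B}_{i})\to p_{i+1}$ for $i\geqslant1$; $\mathbf{K4B}_{n}=\mathbf{K4}\oplus\mathsf{B}_{n}$. For $k\geqslant1$, $$\mathsf{Wid}_{k}^{+}=\Big(q\wedge\Diamond\big(\Box\lnot q\wedge\bigwedge_{0\leqslant i\leqslant k}\Diamond p_{i}\big)\Big)\to\bigvee_{0\leqslant i\neq j\leqslant k}\Diamond(p_{i}\wedge(p_{j}\vee\Diamond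 p_{j})),$$ $$\mathsf{Wid}_{k}^{\bullet}=\bigwedge_{0\leqslant i\leqslant k}\Diamond(p_{i}\wedge\Box\lnot p_{i})\to\bigvee_{0\leqslant i\neq j\leqslant k}\Diamond(p_{i}\wedge(p_{j}\vee\Diamond p_{j})).$$ *)

(* Defs.v *)
From mathcomp Require Import all_boot.
From mathcomp Require Import boolp classical_sets functions cardinality.
From Stdlib Require Cantor.

Set Implicit Arguments.
Unset Strict Implicit.
Unset Printing Implicit Defensive.

Local Open Scope classical_set_scope.
Local Open Scope nat_scope.

Inductive form : Type :=
| Var of nat
| Bot
| Imp of form & form
| Box of form.

Definition Top : form := Imp Bot Bot.
Definition Neg (a : form) : form := Imp a Bot.
Definition Or (a b : form) : form := Imp (Neg a) b.
Definition And (a b : form) : form := Neg (Imp a (Neg b)).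
Definition Dia (a : form) : form := Neg (Box (Neg a)).

(* The variables p_i (i >= 0) and q are pairwise distinct. *)
Definition qvar : form := Var 0.
Definition pvar (i : nat) : form := Var i.+1.

Fixpoint subst (s : nat -> form) (a : form) : form :=
  match a with
  | Var i => s i
  | Bot => Bot
  | Imp b c => Imp (subst s b) (subst s c)
  | Box b => Box (subst s b)
  end.

(* Boxed formulas, like variables, are atoms for truth-functional evaluation. *)
Fixpoint tf_eval (v : form -> bool) (a : form) : bool :=
  match a with
  | Bot => false
  | Imp b c => tf_eval v b ==> tf_eval v c
  | Var _ | Box _ => v a
  end.

Definition tautology (a : form) : Prop := forall v, tf_eval v a.

Definition axK : form :=
  Imp (Box (Imp (pvar 0) qvar)) (Imp (Box (pvar 0)) (Box qvar)).

Definition ax4 : form := Imp (Box (pvar 0)) (Box (Box (pvar 0))).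

Record modal_logic (L : set form) : Prop := ModalLogic {
  ml_taut : forall a, tautology a -> L a;
  ml_K : L axK;
  ml_mp : forall a b, L (Imp a b) -> L a -> L b;
  ml_subst : forall s a, L a -> L (subst s a);
  ml_nec : forall a, L a -> L (Box a) }.

Definition logicK : set form := smallest modal_logic set0.

Definition logicK4 : set form := smallest modal_logic [set ax4].

Definition oplus (L D : set form) : set form := smallest modal_logic (L `|` D).

Definition extension_of (L L' : set form) : Prop :=
  modal_logic L' /\ L `<=` L'.

Definition finitely_axiomatizable (L : set form) : Prop :=
  exists D : set form, finite_set D /\ L = oplus logicK D.

(* Indexed from 1; the value at 0 is a dummy. *)
Fixpoint axB (n : nat) : form :=
  match n with
  | 0 => Bot
  | 1 => Imp (Dia (Box (pvar 1))) (pvar 1)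
  | (_.+1 as m).+1 =>
      Imp (Dia (And (Box (pvar n)) (Neg (axB m)))) (pvar n)
  end.

Definition logicK4B (n : nat) : set form := oplus logicK4 [set axB n].

Definition wid_concl (k : nat) : form :=
  \big[Or/Bot]_(i < k.+1) \big[Or/Bot]_(j < k.+1 | i != j)
    Dia (And (pvar i) (Or (pvar j) (Dia (pvar j)))).

Definition axWidPlus (k : nat) : form :=
  Imp (And qvar
         (Dia (And (Box (Neg qvar)) (\big[And/Top]_(i < k.+1) Dia (pvar i)))))
      (wid_concl k).

Definition axWidBullet (k : nat) : form :=
  Imp (\big[And/Top]_(i < k.+1) Dia (And (pvar i) (Box (Neg (pvar i)))))
      (wid_concl k).

(* Every set has a characteristic function into bool under the classical
   axioms, so decidability refers to an explicit model of computation: the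
   total recursive functions, as the least class closed under composition,
   primitive recursion and minimisation of regular functions. Only unary
   functions are used; several arguments are packed with Cantor's bijective
   pairing, which is therefore, with its projections, among the initial
   functions. *)
Definition npair (a b : nat) : nat := Cantor.to_nat (a, b).
Definition nfst (n : nat) : nat := (Cantor.of_nat n).1.
Definition nsnd (n : nat) : nat := (Cantor.of_nat n).2.

Inductive recursive : (nat -> nat) -> Prop :=
| rec_zero : recursive (fun=> 0)
| rec_succ : recursive succn
| rec_fst : recursive nfst
| rec_snd : recursive nsnd
| rec_pair f g : recursive f -> recursive g ->
    recursive (fun n => npair (f n) (g n))
| rec_comp f g : recursive f -> recursive g -> recursive (f \o g)
| rec_prim f g h : recursive f -> recursive g ->
    (forall a, h (npair a 0) = f a) ->
    (forall a n, h (npair a n.+1) = g (npair a (npair n (h (npair a n))))) ->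
    recursive h
(* h a is the least n with f (a, n) = 0; as h is total, f is regular. *)
| rec_min f h : recursive f ->
    (forall a, f (npair a (h a)) = 0) ->
    (forall a n, n < h a -> f (npair a n) <> 0) ->
    recursive h.

Fixpoint godel (a : form) : nat :=
  match a with
  | Var i => npair 0 i
  | Bot => npair 1 0
  | Imp b c => npair 2 (npair (godel b) (godel c))
  | Box b => npair 3 (godel b)
  end.

Definition decidable_set (L : set form) : Prop :=
  exists2 f : nat -> nat, recursive f &
    forall a : form, (L a -> f (godel a) = 1) /\ (~ L a -> f (godel a) = 0).

(* Main.v *)
Require Import Defs.
From mathcomp Require Import all_boot.
From mathcomp Require Import boolp classical_sets functions cardinality.
From Stdlib Require List Cantor.

(* Let [L] extend the given logic. In the canonical model of [L], restricted to
   [m] variables, every point has depth at most [n] and so only finitely many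
   modal types; hence the quotient by modal equivalence is a finite frame for
   [L], of computably bounded size.

   Remove the root cluster from a finite rooted frame: by [Wid_1^+] every point
   of the rest sees a chain of clusters, so the rest is a forest of depth at
   most [n] with the roots on top, and by [Wid_k^bullet] no antichain of its
   irreflexive points has more than [k] elements. By induction on the depth,
   p-morphic reduction well-quasi-orders such forests: under Higman's embedding
   of the lists of trees, embedded trees are reduced recursively, and a
   left-over tree, whose top cluster is reflexive, collapses onto the least
   reflexive top cluster.

   If [L] were not finitely axiomatizable, there would be formulas [a_i] of [L]
   and rooted frames [F_i] validating [a_j] for [j < i] but refuting [a_i]; a
   reduction of [F_j] to [F_i] with [i < j] is a contradiction. Decidability
   follows by checking all frames up to the bound against the axioms. *)

Set Implicit Arguments.
Unset Strict Implicit.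
Unset Printing Implicit Defensive.

Local Open Scope classical_set_scope.
Local Open Scope nat_scope.

(** * Kripke semantics *)

Fixpoint sat (T : Type) (R : T -> T -> Prop) (V : nat -> T -> Prop)
    (a : form) (x : T) : Prop :=
  match a with
  | Var i => V i x
  | Bot => False
  | Imp b c => sat R V b x -> sat R V c x
  | Box b => forall y, R x y -> sat R V b y
  end.

(** A frame is a set [D] of points of an ambient type, so that finite frames and their generated
    subframes can share the points of [nat] and one relation. *)
Definition valid (T : Type) (D : set T) (R : T -> T -> Prop) : set form :=
  [set a | forall V x, D x -> sat R V a x].

Section Satisfaction.
Variables (T : Type) (R : T -> T -> Prop).
Implicit Types (V : nat -> T -> Prop) (a b : form) (x : T).

Lemma sat_Or V a b x : sat R V (Or a b) x <-> sat R V a x \/ sat R V b x.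
Proof.
split=> /= [h|[//|//]].
by have [|/h] := pselect (sat R V a x); [left|right].
Qed.

Lemma sat_And V a b x : sat R V (And a b) x <-> sat R V a x /\ sat R V b x.
Proof.
split=> /= [h|[ha hb] /(_ ha hb)//].
by split; apply: contrapT => h'; apply: h => // ? ?; apply: h'.
Qed.

Lemma sat_Dia V a x :
  sat R V (Dia a) x <-> exists y, R x y /\ sat R V a y.
Proof.
split=> /= [h|[y [xy ay]] /(_ y xy)//].
by apply: contrapT => h'; apply: h => y xy ay; apply: h'; exists y.
Qed.

Lemma sat_bigOr V (I : eqType) (r : seq I) (P : pred I) (F : I -> form) x :
  sat R V (\big[Or/Bot]_(i <- r | P i) F i) x <->
  exists i, [/\ i \in r, P i & sat R V (F i) x].
Proof.
elim: r => [|i r IH]; first by rewrite big_nil; split=> [|[? []]].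
rewrite big_cons; case: ifPn => Pi; rewrite ?sat_Or IH; split.
- by case=> [h|[j [jr Pj hj]]]; [exists i|exists j]; rewrite ?mem_head// in_cons jr orbT.
- by case=> j []; rewrite in_cons => /predU1P[-> _|jr Pj] hj; [left|right; exists j].
- by case=> j [jr Pj hj]; exists j; rewrite in_cons jr orbT.
- case=> j []; rewrite in_cons => /predU1P[->|jr] Pj hj; last by exists j.
  by rewrite Pj in Pi.
Qed.

Lemma sat_bigAnd V (I : eqType) (r : seq I) (F : I -> form) x :
  sat R V (\big[And/Top]_(i <- r) F i) x <->
  forall i, i \in r -> sat R V (F i) x.
Proof.
elim: r => [|i r IH]; first by rewrite big_nil; split=> // _ /=.
rewrite big_cons sat_And IH; split=> [[hi hr] j|h].
  by rewrite in_cons => /predU1P[->//|]; apply: hr.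
by split=> [|j jr]; apply: h; rewrite ?mem_head// in_cons jr orbT.
Qed.

Lemma sat_ext V V' a x :
  (forall i y, V i y <-> V' i y) -> sat R V a x <-> sat R V' a x.
Proof.
move=> VV'; elim: a x => [i|//|a IHa b IHb|a IHa] x /=; first exact: VV'.
  by rewrite IHa IHb.
by split=> h y /h; rewrite IHa.
Qed.

Lemma sat_subst V s a x :
  sat R V (subst s a) x <-> sat R (fun i => sat R V (s i)) a x.
Proof.
elim: a x => [i|//|a IHa b IHb|a IHa] x //=; first by rewrite IHa IHb.
by split=> h y /h; rewrite IHa.
Qed.

Lemma sat_tf_eval V a x :
  tf_eval (fun b => `[< sat R V b x >]) a <-> sat R V a x.
Proof.
elim: a => [i||a IHa b IHb|a IHa] /=; [by rewrite asboolE | by split | | by rewrite asboolE].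
rewrite -IHa -IHb; split=> [/implyP//|h]; exact/implyP.
Qed.

Lemma valid_modal_logic (D : set T) :
  (forall x y, D x -> R x y -> D y) -> modal_logic (valid D R).
Proof.
move=> Dcl; split.
- by move=> a ta V x _; apply/sat_tf_eval; apply: ta.
- by move=> V x _ /= h1 h2 y xy; apply: h1 => //; apply: h2.
- by move=> a b hab ha V x Dx; apply: hab => //; apply: ha.
- by move=> s a ha V x Dx; apply/sat_subst; apply: ha.
- by move=> a ha V x Dx y xy; apply: ha; apply: Dcl xy.
Qed.

End Satisfaction.

Definition pmorphism (T T' : Type) (D : set T) (R : T -> T -> Prop)
    (D' : set T') (R' : T' -> T' -> Prop) (f : T -> T') : Prop :=
  [/\ forall x, D x -> D' (f x),
      forall z, D' z -> exists2 x, D x & f x = z,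
      forall x y, D x -> D y -> R x y -> R' (f x) (f y) &
      forall x z, D x -> D' z -> R' (f x) z ->
        exists2 y, D y & R x y /\ f y = z].

(** A valuation on the image is pulled back along [f]; truth then agrees at [x] and [f x], by
    induction on the formula. *)
Lemma pmorphism_valid (T T' : Type) (D : set T) (R : T -> T -> Prop)
    (D' : set T') (R' : T' -> T' -> Prop) (f : T -> T') :
  (forall x y, D x -> R x y -> D y) ->
  (forall x y, D' x -> R' x y -> D' y) ->
  pmorphism D R D' R' f -> valid D R `<=` valid D' R'.
Proof.
move=> Dcl D'cl [fD fonto ffwd fbck] a va V z /fonto[x Dx <-].
have {va} := va (fun i y => V i (f y)) x Dx.
suff E y : D y -> sat R (fun i y => V i (f y)) a y <-> sat R' V a (f y).
  by move/(E _ Dx).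
elim: a y {x Dx} => [i|//|a IHa b IHb|a IHa] x Dx //=.
  by rewrite IHa// IHb.
split=> h y.
  move=> fxy; have [|w Dw [xw <-]] := fbck _ _ Dx _ fxy.
    by apply: D'cl fxy; apply: fD.
  by apply/IHa => //; apply: h.
move=> xy; have Dy := Dcl _ _ Dx xy.
by apply/IHa => //; apply: h; apply: ffwd.
Qed.

(** * Modal logics and their canonical models *)

Lemma smallest_modal_logic (G : set form) : modal_logic (smallest modal_logic G).
Proof.
split.
- by move=> a ta M [ML _]; apply: ml_taut.
- by move=> M [ML _]; apply: ml_K.
- move=> a b hab ha M MG; apply: (ml_mp (proj1 MG) (a := a)); [exact: hab|exact: ha].
- by move=> s a ha M MG; apply: ml_subst (proj1 MG) _ _ _; apply: ha.
- by move=> a ha M MG; apply: ml_nec (proj1 MG) _ _; apply: ha.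
Qed.

Lemma logicK_sub (L : set form) : modal_logic L -> logicK `<=` L.
Proof. by move=> hL; apply: smallest_sub. Qed.

Lemma oplusK_sub (L D : set form) :
  modal_logic L -> D `<=` L -> oplus logicK D `<=` L.
Proof.
by move=> hL DL; apply: smallest_sub => // a [/(logicK_sub hL)|/DL].
Qed.

Lemma oplus_ax (L D : set form) : D `<=` oplus L D.
Proof. by move=> a Da; apply: sub_gen_smallest; right. Qed.

(** Truth-table check in which the values of the component formulas become arbitrary booleans. *)
Ltac prop_taut :=
  let v := fresh in
  move=> v /=;
  repeat match goal with |- context [tf_eval ?v ?a] =>
    let b := fresh in generalize (tf_eval v a) => b; case: b end; by [].

Section Canonical.
Variable L : set form.
Hypothesis hL : modal_logic L.

Record theory (x : set form) : Prop := Theory {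
  th_log : L `<=` x;
  th_mp : forall a b, x (Imp a b) -> x a -> x b }.

Definition complete_theory (x : set form) : Prop :=
  [/\ theory x, ~ x Bot & forall a, x a \/ x (Neg a)].

Lemma th_taut x a : theory x -> tautology a -> x a.
Proof. by move=> hx ta; apply: th_log => //; apply: ml_taut. Qed.

Lemma theory_add x a : theory x -> theory [set b | x (Imp a b)].
Proof.
move=> hx; split=> [b Lb|b c /= hbc hb].
  apply: (th_mp hx (a := b)); last exact: th_log.
  by apply: th_taut => //; prop_taut.
apply: (th_mp hx (a := Imp a b)) => //.
apply: (th_mp hx (a := Imp a (Imp b c))) => //.
by apply: th_taut => //; prop_taut.
Qed.

Lemma lindenbaum x a : theory x -> ~ x a ->
  exists y, [/\ complete_theory y, x `<=` y & ~ y a].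
Proof.
move=> hx nxa.
(* Zorn's lemma is applied to the sets added to [x], not to the supersets of [x], so that the empty
   chain is covered: its union adds nothing. *)
pose P : set (set form) := [set X | theory (x `|` X) /\ ~ (x `|` X) a].
have [|X [[hX nXa] maxX]] := @Zorn_bigcup _ P.
  move=> F FP Ftot; split; last first.
    by case=> // -[X FX Xa]; have [_] := FP _ FX; apply; right.
  split=> [b Lb|b c]; first by left; apply: (th_log hx).
  have key X : F X -> (x `|` X) (Imp b c) -> (x `|` X) b ->
      (x `|` \bigcup_(X in F) X) c.
    move=> FX h1 h2; have [/th_mp h _] := FP _ FX.
    by have [|Xc] := h _ _ h1 h2; [left|right; exists X].
  case=> [h1|[X FX h1]] [h2|[Y FY h2]].
  - by left; apply: th_mp h2.
  - by apply: (key Y) => //; [left|right].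
  - by apply: (key X) => //; [right|left].
  - by have [XY|YX] := Ftot _ _ FX FY; [apply: (key Y)|apply: (key X)] => //;
      right=> //; [apply: XY|apply: YX].
set y := x `|` X in hX nXa.
(* By maximality, the theory generated by [y] and [b] must contain [a]. *)
have key b : ~ y b -> y (Imp b a).
  move=> nyb; apply: contrapT => nyba.
  have yb : y `<=` [set c | y (Imp b c)].
    move=> c yc; apply: (th_mp hX (a := c)) => //.
    by apply: th_taut => //; prop_taut.
  have E : x `|` [set c | y (Imp b c)] = [set c | y (Imp b c)].
    by apply/seteqP; split=> c; [case=> // xc; apply: yb; left|right].
  apply: (maxX [set c | y (Imp b c)]); last first.
    by split; [rewrite E; apply: theory_add | case].
  rewrite properEneq; split.
    apply/eqP => e; apply: nyb; right; rewrite e /=.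
    by apply: th_taut => //; prop_taut.
  by move=> c Xc; apply: yb; right.
exists y; split=> //; last by move=> b; left.
split=> // [yB|b].
  by apply: nXa; apply: (th_mp hX) yB; apply: th_taut => //; prop_taut.
apply: contrapT => /not_orP[/key h1 /key h2]; apply: nXa.
apply: (th_mp hX) h2; apply: (th_mp hX) h1.
by apply: th_taut => //; prop_taut.
Qed.

Definition canonW : Type := {x : set form | complete_theory x}.
Definition canonR (x y : canonW) : Prop :=
  forall a, sval x (Box a) -> sval y a.
Definition canonV (i : nat) (x : canonW) : Prop := sval x (Var i).

Lemma canon_theory (x : canonW) : theory (sval x).
Proof. by case: x => x []. Qed.

Lemma L_box_K a b : L (Imp (Box (Imp a b)) (Imp (Box a) (Box b))).
Proof.
(* In [axK], [qvar] is variable 0 and [pvar 0] is variable 1. *)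
have := ml_subst hL (fun i => if i is 0 then b else a) (ml_K hL).
by [].
Qed.

Lemma truth_lemma a (x : canonW) : sat canonR canonV a x <-> sval x a.
Proof.
elim: a x => [i|//|a IHa b IHb|a IHa] x /=; first by [].
- by case: x => x [].
- rewrite IHa IHb; case: x => x [/= hx nB cx]; split=> [h|h1 h2]; last exact: th_mp h1 h2.
  have [/h xb|xna] := cx a.
    by apply: (th_mp hx) xb; apply: th_taut => //; prop_taut.
  by apply: (th_mp hx) xna; apply: th_taut => //; prop_taut.
- split=> [h|h y /(_ _ h) ya]; last exact/IHa.
  apply: contrapT => nxa.
  have hx := canon_theory x.
  (* The formulas whose box lies in [x] form a theory; a complete theory extending it without [a] is
     a successor of [x] refuting [a]. *)
  have hz : theory [set b | sval x (Box b)].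
    split=> [b Lb|b c /= hbc hb]; first by apply: (th_log hx); apply: (ml_nec hL).
    apply: (th_mp hx) hb; apply: (th_mp hx) hbc.
    by apply: (th_log hx); apply: L_box_K.
  have [y [cy xy nya]] := lindenbaum hz nxa.
  have /h /IHa : canonR x (exist _ y cy) by move=> b /xy.
  by [].
Qed.

Lemma canon_L a s x : L a -> sat canonR canonV (subst s a) x.
Proof.
move=> La; apply/truth_lemma; apply: (th_log (canon_theory x)).
exact: ml_subst.
Qed.

Lemma canon_complete a : ~ L a -> exists x, ~ sat canonR canonV a x.
Proof.
have hT : theory L by split=> // b c; apply: ml_mp.
move=> /(lindenbaum hT)[y [cy _ nya]].
by exists (exist _ y cy) => /truth_lemma.
Qed.

Lemma canon_trans : L ax4 -> forall x y z, canonR x y -> canonR y z -> canonR x z.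
Proof.
move=> L4 x y z xy yz a xa; apply: yz; apply: xy.
apply: (th_mp (canon_theory x)) xa; apply: th_log (canon_theory x) _ _.
exact: ml_subst hL (fun=> a) _ L4.
Qed.

End Canonical.

(** * Depth *)

Section Depth.
Variables (T : Type) (R : T -> T -> Prop).
Definition strict (x y : T) : Prop := R x y /\ ~ R y x.

(** Chains of proper successors are counted with [x] included, so nothing has depth at most 0. *)
Fixpoint depth_le (d : nat) (x : T) : Prop :=
  if d is d'.+1 then forall y, strict x y -> depth_le d' y else False.

(** The chain is numbered from its far end, with [x] last, as the axioms [axB] number their
    variables. *)
Lemma not_depth_le d x : ~ depth_le d x ->
  exists c : nat -> T, c d = x /\ forall i, i < d -> strict (c i.+1) (c i).
Proof.
elim: d x => [|d IH] x h; first by exists (fun=> x).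
have [y [xy /IH[c [cy hc]]]] : exists y, strict x y /\ ~ depth_le d y.
  apply: contrapT => h'; apply: h => y xy; apply: contrapT => ny.
  by apply: h'; exists y.
exists (fun i => if i <= d then c i else x); rewrite ltnn; split=> // i.
move=> hi; have /orP[/eqP->|lid] : (i == d) || (i < d) by rewrite -leq_eqVlt.
  by rewrite leqnn ltnn cy.
by rewrite lid (ltnW lid); apply: hc.
Qed.

(* Each [al i] separates [c i.-1] from its proper predecessor [c i]; then
   [B_i] fails at [c i], by induction on [i]. *)
Lemma axB_refuted V (al : nat -> form) (c : nat -> T) n : 0 < n ->
  (forall i, i < n -> [/\ R (c i.+1) (c i), sat R V (Box (al i.+1)) (c i) &
     ~ sat R V (al i.+1) (c i.+1)]) ->
  ~ sat R (fun i => sat R V (al i.-1)) (axB n) (c n).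
Proof.
case: n => // n _; elim: n => [|n IH] hc.
  have [xy h1 h2] := hc 0 isT.
  by move=> /= h; apply: h2; apply: h => h3; exact: h3 _ xy h1.
have /IH nB : forall i, i < n.+1 -> [/\ R (c i.+1) (c i),
    sat R V (Box (al i.+1)) (c i) & ~ sat R V (al i.+1) (c i.+1)].
  by move=> i hi; apply: hc; apply: ltnW.
have [xy h1 h2] := hc _ (ltnSn n.+1).
pose V' i := sat R V (al i.-1).
move=> h; have {}h : sat R V' (Dia (And (Box (pvar n.+2)) (Neg (axB n.+1))))
  (c n.+2) -> sat R V (al n.+2) (c n.+2) := h.
apply: h2; apply: h; apply/sat_Dia; exists (c n.+1); split=> //.
by apply/sat_And; split.
Qed.

End Depth.

Lemma canon_depth L (hL : modal_logic L) n : 0 < n -> L (axB n) ->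
  forall x, depth_le (@canonR L) n x.
Proof.
move=> n0 LB x; apply: contrapT => nd; have [c [cx hc]] := not_depth_le nd.
(* [al] is numbered from 1 like the variables of [axB]; the failure of [canonR] from [c i] to
   [c i.+1] yields [al i.+1]. *)
have /choice[al hal] i : exists a, i.-1 < n ->
    sval (c i.-1) (Box a) /\ ~ sval (c i.-1.+1) a.
  have [hi|] := boolP (i.-1 < n); last by exists Bot.
  have [_ nr] := hc _ hi; apply: contrapT => h; apply: nr; move=> a ha.
  by apply: contrapT => na; apply: h; exists a.
apply: (@axB_refuted _ (@canonR L) (@canonV L) al c n n0) => [i hi|].
  have [xy _] := hc i hi; split=> //; last first.
    by move/(truth_lemma hL); case: (hal i.+1 hi).
  by apply/(truth_lemma hL); case: (hal i.+1 hi).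
by rewrite cx -sat_subst; apply: canon_L.
Qed.

Lemma valid_depth (T : Type) (D : set T) (R : T -> T -> Prop) n : 0 < n ->
  (forall x y, D x -> R x y -> D y) ->
  valid D R (axB n) -> forall x, D x -> depth_le R n x.
Proof.
move=> n0 Dcl vB x Dx; apply: contrapT => nd; have [c [cx hc]] := not_depth_le nd.
(* The [i]-th variable fails only at [c i]. The proper successor [c i.-1] does not see that point,
   so it satisfies the boxed variable. *)
pose V i y := y <> c i.
apply: (@axB_refuted _ R V Var c n n0) => [i hi|].
  have [xy nyx] := hc i hi; split=> //=.
  by move=> y yz e; apply: nyx; rewrite -e.
by apply: vB; rewrite cx.
Qed.

(** * Finite quotients of models of finite depth *)

(* The type of a point of depth [d.+1] in a model with [m] variables: its atoms,
   the atoms occurring in its cluster, the types of its proper successors. *)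
Fixpoint mtype (m d : nat) : finType :=
  if d is d'.+1
  then ({set 'I_m} * {set {set 'I_m}} * {set mtype m d'})%type : finType
  else unit.

Fixpoint mtype_card (m d : nat) : nat :=
  if d is d'.+1 then 2 ^ m * 2 ^ (2 ^ m) * 2 ^ mtype_card m d' else 1.

Lemma card_mtype m d : #|mtype m d| = mtype_card m d.
Proof.
elim: d => [|d IH] /=; first by rewrite card_unit.
by rewrite !card_prod -!cardsT -!powersetT !card_powerset !cardsT card_ord IH.
Qed.

Section Types.
Variables (T : Type) (R : T -> T -> Prop) (V : nat -> T -> Prop) (m : nat).
Hypothesis Rtr : forall x y z, R x y -> R y z -> R x z.
Hypothesis Vm : forall i x, V i x -> i < m.

Definition atoms (x : T) : {set 'I_m} := finset (fun i : 'I_m => `[< V i x >]).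

Fixpoint typ (d : nat) (x : T) : mtype m d :=
  match d with
  | 0 => tt
  | d'.+1 => (atoms x,
      finset (fun A => `[< exists y, [/\ R x y, R y x & atoms y = A] >]),
      finset (fun t => `[< exists y, strict R x y /\ typ d' y = t >]))
  end.

Lemma eq_atoms x y i : atoms x = atoms y -> V i x -> V i y.
Proof.
move=> /setP e Vx; have := e (Ordinal (Vm Vx)).
by rewrite !finset.in_set => h; apply/asboolP; rewrite -h; exact/asboolP.
Qed.

Lemma strict_cluster x y z : R x y -> R y x -> strict R x z -> strict R y z.
Proof.
move=> xy yx [xz nzx]; split; first exact: Rtr xz.
by move=> zy; apply: nzx; apply: Rtr yx.
Qed.

(** Points of one cluster share their cluster and their proper successors, so their types differ
    only in the atoms. *)
Lemma typ_cluster d x y : R x y -> R y x ->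
  typ d.+1 x = (atoms x, (typ d.+1 y).1.2, (typ d.+1 y).2).
Proof.
move=> xy yx /=; congr (_, _, _); apply/setP => A; rewrite !finset.in_set;
  apply/asboolP/asboolP.
- by case=> z [xz zx <-]; exists z; split=> //; [apply: Rtr xz|apply: Rtr xy].
- by case=> z [xz zx <-]; exists z; split=> //; [apply: Rtr xz|apply: Rtr yx].
- by case=> z [xz <-]; exists z; split=> //; apply: strict_cluster xz.
- by case=> z [xz <-]; exists z; split=> //; apply: strict_cluster xz.
Qed.

Lemma depth_le_cluster d x y : R x y -> R y x -> depth_le R d x -> depth_le R d y.
Proof.
by case: d => // d xy yx h z yz; apply: h; apply: strict_cluster yz.
Qed.

(** Equality of types is a bisimulation: successors inside the cluster are matched by their atoms,
    proper successors by their types of lower depth. *)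
Lemma typ_equiv d x y a : depth_le R d x -> depth_le R d y ->
  typ d x = typ d y -> sat R V a x <-> sat R V a y.
Proof.
elim: d x y a => [//|d IHd] x y a.
suff H x' y' : depth_le R d.+1 x' -> depth_le R d.+1 y' ->
    typ d.+1 x' = typ d.+1 y' -> sat R V a x' -> sat R V a y'.
  by move=> dx dy e; split; apply: H.
move: x y => _ _; elim: a x' y' => [i|//|a IHa b IHb|a IHa] x y dx dy txy.
- by case: txy => e _ _; apply: eq_atoms.
- by move=> /= h ya; apply: (IHb x) => //; apply: h; apply: (IHa y).
- move=> /= h z yz; case: (txy) => _ e1 e2.
  have [zy|nzy] := pselect (R z y).
    have : atoms z \in (typ d.+1 x).1.2.
      by rewrite txy finset.in_set; apply/asboolP; exists z.
    rewrite finset.in_set => /asboolP[w [xw wx ew]].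
    apply: (IHa w); last exact: h.
    + exact: depth_le_cluster dx.
    + exact: depth_le_cluster dy.
    + by rewrite (typ_cluster d wx xw) (typ_cluster d zy yz) txy ew.
  have : typ d z \in (typ d.+1 x).2.
    by rewrite txy finset.in_set; apply/asboolP; exists z.
  rewrite finset.in_set => /asboolP[w [xw ew]].
  apply/(IHd w z) => //; first exact: dx.
    by apply: dy; split.
  by apply: h; case: xw.
Qed.

End Types.

(** Each class of [E] is a union of fibres of [f], so there are at most [#|t|] classes; a class is
    named by a value of [f] picked on it and numbered by the rank of this name. *)
Lemma finite_classes (T : Type) (t : finType) (f : T -> t) (E : T -> T -> Prop) :
  (forall x y, E x y -> E y x) -> (forall x y z, E x y -> E y z -> E x z) ->
  (forall x y, f x = f y -> E x y) ->
  exists N (e : T -> nat), [/\ N <= #|t|, forall x, e x < N,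
    forall x y, e x = e y <-> E x y & forall i, i < N -> exists x, e x = i].
Proof.
move=> Esym Etr fE.
pose c x : option t := [pick u | `[< exists y, E x y /\ f y = u >]].
have cP x : exists2 u, c x = Some u & exists y, E x y /\ f y = u.
  rewrite /c; case: pickP => [u /asboolP hu|/(_ (f x)) /asboolP[]]; first by exists u.
  by exists x; split=> //; apply: fE.
have cE x y : c x = c y <-> E x y.
  split=> [|xy].
    have [u -> [x' [xx' <-]]] := cP x; have [v -> [y' [yy' <-]]] := cP y.
    by case=> /fE x'y'; apply: (Etr _ _ _ xx'); apply: (Etr _ _ _ x'y'); apply: Esym.
  apply: eq_pick => u; apply: asbool_equiv_eq; split=> -[z [hz <-]]; exists z; split=> //.
    by apply: (Etr _ _ _ _ hz); apply: Esym.
  exact: Etr hz.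
pose im := [seq u <- enum t | `[< exists x, c x = Some u >]].
pose e x := if c x is Some u then index u im else 0.
have imP x : exists2 u, c x = Some u & u \in im.
  have [u cx _] := cP x; exists u => //.
  by rewrite mem_filter mem_enum andbT; apply/asboolP; exists x.
exists (size im), e; split.
- by rewrite cardE size_filter count_size.
- by move=> x; rewrite /e; have [u -> uim] := imP x; rewrite index_mem.
- move=> x y; rewrite -cE /e.
  have [u -> uim] := imP x; have [v -> vim] := imP y.
  by split=> [|[->]//] euv; rewrite -(nth_index u uim) euv nth_index.
- move=> i hi; have [u0 _] : exists u0 : t, True by move: hi; case: (im) => // u0; exists u0.
  have := mem_nth u0 hi; rewrite mem_filter => /andP[/asboolP[x cx] _].
  exists x; rewrite /e cx index_uniq//.
  by rewrite filter_uniq// enum_uniq.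
Qed.

Fixpoint maxvar (a : form) : nat :=
  match a with
  | Var i => i.+1
  | Bot => 0
  | Imp b c => maxn (maxvar b) (maxvar c)
  | Box b => maxvar b
  end.

Lemma sat_maxvar (T : Type) (D : set T) (R : T -> T -> Prop) V V' m a x :
  (forall x y, D x -> R x y -> D y) -> maxvar a <= m ->
  (forall i y, i < m -> D y -> V i y <-> V' i y) -> D x ->
  sat R V a x <-> sat R V' a x.
Proof.
move=> Dcl + VV'; elim: a x => [i|//|a IHa b IHb|a IHa] x /= am Dx.
- exact: VV'.
- by move: am; rewrite geq_max => /andP[am bm]; rewrite IHa// IHb.
- by split=> h y xy; have := h y xy; rewrite IHa//; apply: Dcl xy.
Qed.

Lemma separating_formula (T : Type) (R : T -> T -> Prop) V (I : eqType)
    (r : seq I) (c : I -> T) x :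
  (forall i, i \in r -> ~ forall a, sat R V a x <-> sat R V a (c i)) ->
  exists a, sat R V a x /\ forall i, i \in r -> ~ sat R V a (c i).
Proof.
elim: r => [|i r IH] h; first by exists Top; split=> //= ?.
have [|a [ax ha]] := IH; first by move=> j jr; apply: h; rewrite in_cons jr orbT.
suff [b [bx hb]] : exists b, sat R V b x /\ ~ sat R V b (c i).
  exists (And a b); split; first exact/sat_And.
  by move=> j; rewrite in_cons => /predU1P[->|/ha h'] /sat_And[].
have /h/existsNP[b hb] := mem_head i r.
have [bx|nbx] := pselect (sat R V b x).
  by exists b; split=> // bi; apply: hb.
exists (Neg b); split=> // nbi; apply: hb; split=> // bi; exact: False_ind (nbi bi).
Qed.

(** The frame is the quotient of the canonical model by equivalence in the first [m] variables. Each
    class is defined by a formula, so every valuation on the quotient comes from a substitution;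
    closure of [L] under substitution then gives validity, not just truth in one model. *)
Theorem finite_model_property (L : set form) n (a : form) m :
  modal_logic L -> L ax4 -> 0 < n -> L (axB n) -> ~ L a -> maxvar a <= m ->
  exists N (R : rel nat), [/\ N <= mtype_card m n,
    forall x y, R x y -> x < N /\ y < N,
    L `<=` valid [set x | x < N] R &
    ~ valid [set x | x < N] R a].
Proof.
move=> hL L4 n0 LB nLa am.
(* Variables from [m] on are made false everywhere, so that there are finitely many types. *)
pose R := @canonR L; pose V i x := i < m /\ @canonV L i x.
have Rtr := canon_trans hL L4; have Rd := canon_depth hL n0 LB.
pose E x y := forall b, sat R V b x <-> sat R V b y.
have Vm i x : V i x -> i < m by case.
have [||x y fxy b|N [e [cN eN eE eon]]] := @finite_classes _ _ (typ R V m n) E.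
- by move=> x y xy b; rewrite xy.
- by move=> x y z xy yz b; rewrite xy.
- exact: (typ_equiv Rtr Vm _ (Rd x) (Rd y) fxy).
have /choice[c hc] i : exists x, i < N -> e x = i.
  have [/eon[x <-]|] := boolP (i < N); first by exists x.
  have [w _] := canon_complete hL nLa; by exists w.
have ce x : E (c (e x)) x by apply/eE; apply: hc.
have /choice[de hde] i : exists b, i < N -> forall y, sat R V b y <-> e y = i.
  have [iN|] := boolP (i < N); last by exists Bot.
  have [j|b [bi hb]] := @separating_formula _ R V _ [seq j <- iota 0 N | j != i] c (c i).
    rewrite mem_filter mem_iota add0n => /andP[/eqP ij jN] /eE.
    by rewrite !hc// => ji; apply: ij.
  exists b => _ y; split=> [yb|yi]; last by rewrite -(ce y) yi.
  apply: contrapT => /eqP yi; apply: (hb (e y)); last by rewrite ce.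
  by rewrite mem_filter yi mem_iota add0n eN.
pose R' i j := `[< exists x y, [/\ e x = i, e y = j & R x y] >].
(* The class [j] is defined by [de j], and the truth of [Dia (de j)] passes from one point of a
   class to the others. *)
have bck x j : R' (e x) j -> exists2 y, R x y & e y = j.
  move=> /asboolP[x' [y' [/eE xx' ey xy']]].
  have jN : j < N by rewrite -ey.
  have /(sat_Dia R V (de j)) : sat R V (Dia (de j)) x.
    by rewrite -(xx' (Dia (de j))) sat_Dia; exists y'; rewrite hde.
  by case=> y [xy]; rewrite hde// => ?; exists y.
have satE V' s : (forall p x, V' p (e x) <-> sat R V (s p) x) ->
    forall b x, sat R' V' b (e x) <-> sat R V (subst s b) x.
  move=> Vs; elim=> [p|//|b1 IH1 b2 IH2|b IHb] x /=; first exact: Vs.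
    by rewrite IH1 IH2.
  split=> [h y xy|h j /bck[y xy <-]]; last by apply/IHb; apply: h.
  by apply/IHb; apply: h; apply/asboolP; exists x, y.
have VE b x : sat R V b x <-> sat R (@canonV L) (subst (fun i => if i < m then Var i else Bot) b) x.
  rewrite sat_subst; apply: sat_ext => i y; rewrite /V.
  by case: ifP => _; split=> // -[].
exists N, R'; split.
- by rewrite -card_mtype.
- by move=> i j /asboolP[x [y [<- <- _]]].
- move=> b Lb V' _ /= /eon[x <-].
  (* A variable is replaced by the disjunction of the formulas defining the classes where [V'] makes
     it true. *)
  apply/(satE V' (fun p => \big[Or/Bot]_(i <- iota 0 N | `[< V' p i >]) de i)).
    move=> p y; rewrite sat_bigOr; split=> [py|[i []]].
      exists (e y); rewrite mem_iota add0n eN; split=> //; first exact/asboolP.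
      exact/(hde _ (eN y)).
    by rewrite mem_iota add0n /= => iN /asboolP pi /(hde _ iN) ->.
  apply/VE; apply: canon_L => //; exact: ml_subst.
- move=> va; have [x nx] := canon_complete hL nLa; apply: nx.
  have := va (fun p i => V p (c i)) (e x) (eN x).
  rewrite (satE _ Var) => [|p y]; last exact: (ce y (Var p)).
  rewrite sat_subst => h; apply/(@sat_maxvar _ setT _ _ V m) => // i y im _.
  by rewrite /V im; split=> [?|[]].
Qed.

(** * Well-quasi-orders *)

Definition increasing (f : nat -> nat) := forall i j, i < j -> f i < f j.

Lemma increasing_step f : (forall i, f i < f i.+1) -> increasing f.
Proof.
move=> h i j; elim: j => // j IH; rewrite ltnS leq_eqVlt.
by case/predU1P=> [->//|/IH/ltn_trans]; apply.
Qed.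

(* Transitivity of [le] is never needed: Ramsey's theorem replaces it. *)
Definition wqo (T : Type) (P : T -> Prop) (le : T -> T -> Prop) : Prop :=
  forall s : nat -> T, (forall i, P (s i)) ->
    exists i j, i < j /\ le (s i) (s j).

Definition infinite (I : nat -> Prop) : Prop :=
  forall m, exists2 n, m <= n & I n.

Lemma infinite_split (I A : nat -> Prop) : infinite I ->
  infinite (fun n => I n /\ A n) \/ infinite (fun n => I n /\ ~ A n).
Proof.
move=> hI; have [|/existsNP[m hm]] := pselect (infinite (fun n => I n /\ A n)).
  by left.
right=> p; have [n] := hI (maxn m p); rewrite geq_max => /andP[mn pn] In.
by exists n => //; split=> // An; apply: hm; exists n.
Qed.

Lemma infinite_increasing (I : nat -> Prop) : infinite I ->
  exists2 f, increasing f & forall i, I (f i).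
Proof.
move=> hI; have /choice[nx hnx] m : exists n, m <= n /\ I n.
  by have [n] := hI m; exists n.
have nxle m : m <= nx m by have [] := hnx m.
have nxI m : I (nx m) by have [] := hnx m.
pose f i := iter i (fun p => nx p.+1) (nx 0).
exists f; last by case=> [|i]; apply: nxI.
by apply: increasing_step => i /=; apply: nxle.
Qed.

(** Infinite sets are shrunk step by step, so that the point chosen at each step relates to all
    later ones in the same way; infinitely many choices then share one colour. *)
Lemma ramsey (R : nat -> nat -> Prop) : exists f, increasing f /\
  ((forall i j, i < j -> R (f i) (f j)) \/ (forall i j, i < j -> ~ R (f i) (f j))).
Proof.
pose st := {I : nat -> Prop | infinite I}.
(* A step returns the smaller set, the chosen point and its colour. *)
have hst (s : st) : exists t : st * nat * bool, sval s t.1.2 /\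
  forall y, sval t.1.1 y -> [/\ sval s y, t.1.2 < y & (t.2 <-> R t.1.2 y)].
  case: s => I hI /=; have [x _ Ix] := hI 0.
  pose I1 y := I y /\ x < y.
  have hI1 : infinite I1.
    move=> m; have [n] := hI (maxn m x.+1); rewrite geq_max => /andP[mn xn] In.
    by exists n.
  have [h|h] := infinite_split (R x) hI1.
    by exists (exist _ _ h, x, true); split=> //= y [[Iy xy] Rxy].
  by exists (exist _ _ h, x, false); split=> //= y [[Iy xy] Rxy].
have [nx hnx] := choice hst.
have i0 : infinite (fun=> True) by move=> m; exists m.
pose S := fix S i : st := if i is i'.+1 then (nx (S i')).1.1 else exist _ _ i0.
pose x i := (nx (S i)).1.2; pose c i := (nx (S i)).2.
have Sx i j : i <= j -> sval (S j) `<=` sval (S i).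
  elim: j => [|j IH]; first by rewrite leqn0 => /eqP->.
  rewrite leq_eqVlt => /predU1P[->//|ij] y /= hy; apply: (IH ij).
  by have [_ /(_ y hy)[]] := hnx (S j).
have xx i j : i < j -> x i < x j /\ (c i <-> R (x i) (x j)).
  move=> ij; have [_ /(_ (x j))[]] := hnx (S i); last by [].
  by apply: (Sx _ _ ij); case: (hnx (S j)).
have [h|h] := @infinite_split (fun=> True) c (fun m => ex_intro2 _ _ m (leqnn m) I).
all: have [f fi fc] := infinite_increasing h; exists (x \o f); split=> [i j ij|].
- by have [] := xx _ _ (fi _ _ ij).
- by left=> i j ij; have [_ <-] := xx _ _ (fi _ _ ij); have [] := fc i.
- by have [] := xx _ _ (fi _ _ ij).
- by right=> i j ij; have [_ <-] := xx _ _ (fi _ _ ij); have [] := fc i.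
Qed.

(** Of the two homogeneous cases in Ramsey's theorem, the second would be a bad sequence. *)
Lemma wqo_perfect (T : Type) (P : T -> Prop) le (s : nat -> T) :
  wqo P le -> (forall i, P (s i)) ->
  exists2 f, increasing f & forall i j, i < j -> le (s (f i)) (s (f j)).
Proof.
move=> hw Ps; have [f [fi [h|h]]] := ramsey (fun i j => le (s i) (s j)).
  by exists f.
have [i [j [ij hij]]] := hw (s \o f) (fun i => Ps (f i)).
by case: (h _ _ ij).
Qed.

Lemma wqo_and (T : Type) (P : T -> Prop) le1 le2 :
  wqo P le1 -> wqo P le2 -> wqo P (fun x y => le1 x y /\ le2 x y).
Proof.
move=> h1 h2 s Ps; have [f fi hf] := wqo_perfect h1 Ps.
have [i [j [ij hij]]] := h2 (s \o f) (fun i => Ps (f i)).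
by exists (f i), (f j); split; [apply: fi|split=> //; apply: hf].
Qed.

Lemma wqo_map (T U : Type) (P : T -> Prop) (Q : U -> Prop) (le : U -> U -> Prop)
  (g : T -> U) : wqo Q le -> (forall x, P x -> Q (g x)) ->
  wqo P (fun x y => le (g x) (g y)).
Proof. by move=> hw PQ s Ps; apply: (hw (g \o s)) => i; apply: PQ. Qed.

(** Each strict descent lowers the bound [m] on the current value, so the search ends. *)
Lemma wqo_leq : wqo (fun _ : nat => True) leq.
Proof.
move=> s _; suff H m : forall a, s a <= m -> exists i j, i < j /\ s i <= s j.
  exact: (H (s 0) 0).
elim: m => [|m IH] a am.
  by exists a, a.+1; split=> //; apply: leq_trans am _.
have [h|h] := leqP (s a) (s a.+1); first by exists a, a.+1.
by apply: (IH a.+1); rewrite -ltnS; apply: leq_trans h am.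
Qed.

Lemma wqo_eq_bounded k : wqo (fun x => x <= k) (@eq nat).
Proof.
move=> s sk; pose f (i : 'I_k.+2) : 'I_k.+1 := inord (s i).
have /injectivePn[i [j ij fij]] : ~~ injectiveb f.
  by apply/injectiveP => /leq_card; rewrite !card_ord ltnn.
have e : s i = s j.
  by have := congr1 val fij; rewrite /= !inordK ?ltnS.
case: (ltngtP i j) => [h|h|/val_inj h]; last by rewrite h eqxx in ij.
  by exists i, j.
by exists j, i.
Qed.

Section Higman.
Variables (T : Type) (P : T -> Prop) (le : T -> T -> Prop).

Inductive emb : seq T -> seq T -> Prop :=
| emb_nil l : emb [::] l
| emb_cons a b l l' : le a b -> emb l l' -> emb (a :: l) (b :: l')
| emb_skip b l l' : emb l l' -> emb l (b :: l').

Fixpoint all_in (l : seq T) : Prop := if l is a :: l' then P a /\ all_in l' else True.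

Definition bad (s : nat -> seq T) : Prop :=
  (forall i, all_in (s i)) /\ forall i j, i < j -> ~ emb (s i) (s j).

Lemma minimal_bad_step n s : bad s -> exists s', [/\ bad s',
  forall i, i < n -> s' i = s i &
  forall t, bad t -> (forall i, i < n -> t i = s i) -> size (s' n) <= size (t n)].
Proof.
move=> bs.
pose Q m := `[< exists s', [/\ bad s', forall i, i < n -> s' i = s i & size (s' n) = m] >].
have exQ : exists m, Q m by exists (size (s n)); apply/asboolP; exists s.
case: (ex_minnP exQ) => m /asboolP[s' [bs' es' sm]] hm.
exists s'; split=> // t bt et; rewrite sm; apply: hm; apply/asboolP.
by exists t.
Qed.

(** Nash-Williams' minimal bad sequence: entries are fixed one after the other, each as short as the
    earlier ones permit in a bad sequence. *)
Lemma minimal_bad s0 : bad s0 -> exists s, bad s /\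
  forall n t, bad t -> (forall i, i < n -> t i = s i) -> size (s n) <= size (t n).
Proof.
move=> bs0.
have /choice[nx hnx] (p : nat * {s | bad s}) : exists s' : {s | bad s},
  (forall i, i < p.1 -> sval s' i = sval p.2 i) /\
  forall t, bad t -> (forall i, i < p.1 -> t i = sval p.2 i) ->
    size (sval s' p.1) <= size (t p.1).
  case: p => n [s bs]; have [s' [bs' h1 h2]] := minimal_bad_step n bs.
  by exists (exist _ s' bs').
(* The first [n] entries of [S n] are final; [s] collects the final entries. *)
pose S := fix S n : {s | bad s} :=
  if n is n'.+1 then nx (n', S n') else exist _ s0 bs0.
pose s n := sval (S n.+1) n.
have Ss m n : n < m -> sval (S m) n = s n.
  elim: m => // m IH; rewrite ltnS leq_eqVlt => /predU1P[->//|nm].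
  by have [/(_ n nm) + _] := hnx (m, S m); rewrite /= IH // => ->.
exists s; split.
  split=> [i|i j ij]; first by have [h _] := svalP (S i.+1); apply: h.
  rewrite -(Ss j.+1 i) ?ltnS 1?ltnW//.
  by have [_ h] := svalP (S j.+1); apply: h.
move=> n t bt et; have [_ h] := hnx (n, S n); apply: h => // i ni.
by rewrite et// Ss.
Qed.

Lemma higman : wqo P le -> wqo all_in emb.
Proof.
move=> hw s0 Ps0; apply: contrapT => nb.
have /minimal_bad[s [[Ps bs] ms]] : bad s0.
  by split=> // i j ij h; apply: nb; exists i, j.
have sE i : exists p : T * seq T, s i = p.1 :: p.2.
  have := bs i i.+1 (ltnSn i).
  by case: (s i) => [[]|a l _]; [constructor | exists (a, l)].
have [p hp] := choice sE.
have Pp i : P (p i).1 by have := Ps i; rewrite hp => -[].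
have [f fi hf] := wqo_perfect (s := fst \o p) hw Pp.
(* From position [f 0] on, the minimal bad sequence is replaced by its tails along [f], whose heads
   increase; the result is still bad, but shorter at [f 0]. *)
pose t i := if i < f 0 then s i else (p (f (i - f 0))).2.
have bt : bad t.
  split=> [i|i j ij].
    rewrite /t; case: ifP => // _; have := Ps (f (i - f 0)).
    by rewrite hp => -[].
  rewrite /t; case: (ltnP j (f 0)) => jf.
    by rewrite (ltn_trans ij jf); apply: bs.
  have fj : f 0 <= f (j - f 0).
    by case: (j - f 0) => // d; apply: ltnW; apply: fi.
  case: ifPn => [ilt|]; last rewrite -leqNgt => fi0.
    move=> h; apply: (bs i (f (j - f 0))); first exact: leq_trans fj.
    by rewrite [s (f _)]hp; apply: emb_skip.
  have ij' : i - f 0 < j - f 0 by rewrite ltn_sub2r//; apply: leq_ltn_trans ij.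
  move=> h; apply: (bs _ _ (fi _ _ ij')); rewrite hp [s (f (j - _))]hp.
  by apply: emb_cons => //; apply: (hf _ _ ij').
suff : size (s (f 0)) <= size (t (f 0)).
  by rewrite /t ltnn subnn [s (f 0)]hp /= ltnn.
by apply: ms => // i hi; rewrite /t hi.
Qed.

End Higman.

(** The matching is read backwards, from [l'] to [l], since reductions map the larger piece onto the
    smaller. Equal lengths leave no entry of [l'] unmatched. *)
Lemma emb_map_matching (T : Type) (le : T -> T -> Prop) (g g' : nat -> T) l l' :
  uniq l' -> emb le (map g l) (map g' l') ->
  exists h : nat -> option nat,
    [/\ forall y x, h y = Some x -> [/\ y \in l', x \in l & le (g x) (g' y)],
        forall x, x \in l -> exists2 y, y \in l' & h y = Some x &
        size l = size l' -> forall y, y \in l' -> h y <> None].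
Proof.
elim: l' l => [|b l' IH] l.
  case: l => [|x l] _ e; last by inversion e.
  by exists (fun=> None); split.
move=> /= /andP[bl' ul'] e.
have size_emb (m m' : seq T) : emb le m m' -> size m <= size m'.
  by elim=> [l0|x y l0 l1 _ _ h|y l0 l1 _ h] //=; apply: leqW.
inversion e as [l0 e1 e2|a b0 m m' hab hm e1 e2|b0 m m' hm e1 e2].
- by case: l e e1 => // _ _; exists (fun=> None); split.
- case: l e e1 => // x l e [ea em].
  rewrite em in hm; have [h [h1 h2 h3]] := IH l ul' hm.
  exists (fun y => if y == b then Some x else h y); split.
  + move=> y z; case: eqP => [-> [<-]|_ /h1[yl zl hz]].
      by rewrite !mem_head; split=> //; rewrite -ea.
    by rewrite !in_cons yl zl !orbT.
  + move=> z; rewrite in_cons => /predU1P[->|/h2[y yl hy]].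
      by exists b; rewrite ?mem_head ?eqxx.
    exists y; first by rewrite in_cons yl orbT.
    by case: eqP => // yb; rewrite -yb yl in bl'.
  + by move=> [ss] y; rewrite in_cons; case: eqP => //= _; apply: h3.
- have [h [h1 h2 h3]] := IH l ul' hm; exists h; split.
  + by move=> y x /h1[yl xl ?]; rewrite in_cons yl orbT.
  + by move=> x /h2[y yl hy]; exists y; rewrite // in_cons yl orbT.
  + by move: (size_emb _ _ hm); rewrite !size_map => + E; rewrite E /= ltnn.
Qed.

(** * Reductions between finite forests *)

Definition piece : Type := (rel nat * seq nat)%type.

(** The larger side [q] is mapped onto [p]: validity passes from [q] to [p] by [pmorphism_valid]
    once both are closed under successors. *)
Definition red (p q : piece) : Prop :=
  exists f, pmorphism [set x | x \in q.2] q.1 [set x | x \in p.2] p.1 f.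

(** Roots are on top, since it is the successors of a point that form a chain. The width bound
    concerns irreflexive points only: surplus reflexive trees can be collapsed. *)
Definition forest (k : nat) (p : piece) : Prop :=
  [/\ uniq p.2,
      {in p.2 & &, forall x y z, p.1 x y -> p.1 y z -> p.1 x z},
      {in p.2 & &, forall x y z, p.1 x y -> p.1 x z ->
         [\/ y = z, p.1 y z | p.1 z y]} &
      forall s, uniq s -> {subset s <= p.2} ->
        (forall x, x \in s -> ~~ p.1 x x) ->
        {in s &, forall x y, x != y -> ~~ p.1 x y} -> size s <= k].

Definition below (p : piece) (c : nat) : seq nat :=
  [seq x <- p.2 | p.1 x c & ~~ p.1 c x].

Definition cluster (p : piece) (c : nat) : seq nat :=
  [seq x <- p.2 | (x == c) || p.1 x c && p.1 c x].

Definition block (p : piece) (c : nat) : seq nat :=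
  [seq x <- p.2 | (x == c) || p.1 x c].

(** Depth is counted towards predecessors, so that cutting off a top cluster lowers it. *)
Fixpoint down_depth (d : nat) (p : piece) : Prop :=
  if d is d'.+1 then forall c, c \in p.2 -> down_depth d' (p.1, below p c)
  else p.2 = [::].

Lemma forest_sub k R S S' : uniq S' -> {subset S' <= S} ->
  forest k (R, S) -> forest k (R, S').
Proof.
move=> uS' ss [_ /= tr ch irr]; split=> //=.
- by move=> x y z /ss xS /ss yS /ss zS; apply: tr.
- by move=> x y z /ss xS /ss yS /ss zS; apply: ch.
- by move=> s us sS'; apply: irr => // x /sS' /ss.
Qed.

Lemma forest_below k p c : forest k p -> forest k (p.1, below p c).
Proof.
case: p => R S hf; apply: forest_sub (hf).
  by case: hf => uS _ _ _; apply: filter_uniq.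
exact: mem_subseq (filter_subseq _ _).
Qed.

Lemma count_ltn (T : eqType) (a b : pred T) (s : seq T) y :
  {in s, forall x, a x -> b x} -> y \in s -> b y -> ~~ a y ->
  count a s < count b s.
Proof.
elim: s => //= x s IH ab; rewrite in_cons => ys yb nya.
have ab' : {in s, forall x, a x -> b x}.
  by move=> z zs; apply: ab; rewrite in_cons zs orbT.
case/predU1P: ys => [<-|ys].
  rewrite yb (negbTE nya) add0n add1n ltnS -!size_filter.
  rewrite -[X in size X <= _](@eq_in_filter _ (predI a b)).
    by rewrite filter_predI size_filter -[in X in _ <= X]count_predT sub_count.
  by move=> z zs /=; case: (boolP (a z)) => // /(ab' _ zs) ->.
rewrite -addnS leq_add ?IH//.
by have := ab x (mem_head _ _); case: (a x) => // ->.
Qed.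

(** * Blocks of a forest, one for each top cluster *)

Section Blocks.
Variables (k : nat) (p : piece).
Hypothesis hp : forest k p.
Local Notation R := p.1.
Local Notation S := p.2.

Let tr x y z : x \in S -> y \in S -> z \in S -> R x y -> R y z -> R x z.
Proof. by case: hp => _ h _ _ xS yS zS; apply: h. Qed.

Let ch x y z : x \in S -> y \in S -> z \in S -> R x y -> R x z ->
  [\/ y = z, R y z | R z y].
Proof. by case: hp => _ _ h _ xS yS zS; apply: h. Qed.

Definition top (y : nat) : bool := all (fun z => R y z ==> R z y) S.
Definition over_top (x y : nat) : bool := top y && ((y == x) || R x y).
(** A representative of the top cluster above [x]. Taking the first suitable point in the order of
    [S] gives all points of a block the same one. *)
Definition tp (x : nat) : nat := nth x S (find (over_top x) S).
Definition reps : seq nat := undup (map tp S).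

Lemma topP y z : top y -> z \in S -> R y z -> R z y.
Proof. by move=> /allP h /h /implyP. Qed.

Lemma has_top x : x \in S -> has (over_top x) S.
Proof.
(* The induction is on the number of proper successors. *)
pose n x := count (fun z => R x z && ~~ R z x) S.
have [m] := ubnP (n x); elim: m x => // m IH x; rewrite ltnS => nx xS.
have [tx|] := boolP (top x).
  by apply/hasP; exists x; rewrite // /over_top tx eqxx.
case/allPn => y yS; rewrite negb_imply => /andP[xy nyx].
have /IH /(_ yS) /hasP[z zS /andP[tz yz]] : n y < m.
  apply: leq_trans nx; apply: (@count_ltn _ _ _ _ y) => //=.
  - move=> z zS /andP[yz nzy]; rewrite (tr xS yS zS xy yz) /=.
    by apply: contra nyx => zx; rewrite (tr yS zS xS yz zx).
  - by rewrite xy.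
  - by rewrite andbN.
apply/hasP; exists z; rewrite // /over_top tz /=.
by case/predU1P: yz => [->|/(tr xS yS zS xy) ->]; rewrite ?xy orbT.
Qed.

Lemma tpP x : x \in S ->
  [/\ tp x \in S, top (tp x) & (tp x == x) || R x (tp x)].
Proof.
move=> /has_top h; have := nth_find x h; rewrite -/(tp x) => /andP[? ?].
by split=> //; apply: mem_nth; rewrite -has_find.
Qed.

(** If [x] sees [y], the chain condition makes every top point above [x] comparable with [y], hence
    above [y] by maximality. *)
Lemma over_top_eq x y z : x \in S -> y \in S -> z \in S -> R x y ->
  over_top x z = over_top y z.
Proof.
move=> xS yS zS xy; rewrite /over_top; have [tz /=|//] := boolP (top z).
apply/idP/idP => /predU1P[e|xz].
- by move: tz; rewrite e => /topP -> //; rewrite orbT.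
- case: (ch xS yS zS xy xz) => [->|->|zy]; rewrite ?eqxx ?orbT//.
  by rewrite (topP tz yS zy) orbT.
- by rewrite e xy orbT.
- by rewrite (tr xS yS zS xy xz) orbT.
Qed.

Lemma tp_eq x y : x \in S -> y \in S -> R x y -> tp x = tp y.
Proof.
move=> xS yS xy; rewrite /tp.
have -> : find (over_top x) S = find (over_top y) S.
  have : forall z, z \in S -> over_top x z = over_top y z.
    by move=> z zS; apply: over_top_eq.
  by elim: S => //= a s IH h; rewrite h ?mem_head// IH// => z zs; apply: h; rewrite in_cons zs orbT.
by apply: set_nth_default; rewrite -has_find; apply: has_top.
Qed.

Lemma tp_tp x : x \in S -> tp (tp x) = tp x.
Proof.
move=> xS; have [tS _ /predU1P[e|h]] := tpP xS; first by rewrite !e.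
exact/esym/tp_eq.
Qed.

Lemma reps_sub c : c \in reps -> [/\ c \in S, top c & tp c = c].
Proof.
rewrite mem_undup => /mapP[x xS ->]; have [h1 h2 _] := tpP xS.
by split=> //; apply: tp_tp.
Qed.

Lemma mem_reps x : x \in S -> tp x \in reps.
Proof. by move=> xS; rewrite mem_undup; apply: map_f. Qed.

(** Blocks are the fibres of [tp], and so partition the forest. *)
Lemma mem_block c x : c \in reps -> (x \in block p c) = (x \in S) && (tp x == c).
Proof.
move=> cr; have [cS tc tpc] := reps_sub cr.
rewrite mem_filter andbC; case xS : (x \in S) => //=.
apply/idP/eqP => [/predU1P[->//|xc]|<-]; first by rewrite (tp_eq xS cS).
by have [_ _] := tpP xS; rewrite eq_sym.
Qed.

Lemma block_split c x : x \in block p c -> x \in cluster p c \/ x \in below p c.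
Proof.
rewrite !mem_filter => /andP[+ ->]; rewrite !andbT.
by case: (x == c) => /=; [left|move=> ->; case: (R c x); [left|right]].
Qed.

Lemma cluster_block c : {subset cluster p c <= block p c}.
Proof.
move=> x; rewrite !mem_filter => /andP[+ ->]; rewrite andbT.
by case: (x == c) => //= /andP[].
Qed.

Lemma below_block c : {subset below p c <= block p c}.
Proof.
by move=> x; rewrite !mem_filter => /andP[/andP[-> _] ->]; rewrite orbT.
Qed.

Lemma cluster_below c x : x \in cluster p c -> x \notin below p c.
Proof.
rewrite !mem_filter => /andP[+ _]; apply: contraL => /andP[/andP[xc ncx] _].
by case: eqP => [e|_] /=; [move: xc ncx; rewrite e => ->|rewrite negb_and ncx orbT].
Qed.

Lemma cluster_rel c x y : c \in S -> R c c -> x \in block p c ->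
  y \in cluster p c -> R x y.
Proof.
move=> cS cc; rewrite !mem_filter => /andP[xc xS] /andP[cy yS].
have {}xc : R x c by case/predU1P: xc => [->|].
by case/predU1P: cy => [->//|/andP[_ cy]]; apply: (tr xS cS yS).
Qed.

Lemma below_rel c x y : c \in S -> x \in below p c -> y \in cluster p c -> R x y.
Proof.
move=> cS; rewrite !mem_filter => /andP[/andP[xc _] xS] /andP[cy yS].
by case/predU1P: cy => [->//|/andP[_ cy]]; apply: (tr xS cS yS).
Qed.

Lemma cluster_refl c x y : c \in S -> x \in cluster p c -> y \in block p c ->
  R x y -> R c c /\ y \in cluster p c.
Proof.
move=> cS; rewrite !mem_filter => /andP[xc xS] /andP[yc yS] xy.
have cy : R c y.
  by case/predU1P: xc => [<-//|/andP[_ cx]]; apply: (tr cS xS yS).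
have cc : R c c.
  by case/predU1P: (yc) => [e|yc']; [rewrite -{2}e | apply: (tr cS yS cS)].
by split; rewrite // cy yS !andbT.
Qed.

Lemma block_closed c x y : c \in reps -> x \in block p c -> y \in S ->
  R x y -> y \in block p c.
Proof.
move=> cr; rewrite !mem_block// => /andP[xS /eqP <-] yS xy.
by rewrite yS (tp_eq xS yS xy) eqxx.
Qed.

Lemma mem_cluster c : c \in S -> c \in cluster p c.
Proof. by move=> cS; rewrite mem_filter eqxx cS. Qed.

(** Related points share their representative, so distinct representatives are unrelated and the
    irreflexive ones form an antichain. *)
Lemma irr_reps : size [seq c <- reps | ~~ R c c] <= k.
Proof.
case: hp => uS _ _; apply.
- by rewrite filter_uniq// undup_uniq.
- by move=> c; rewrite mem_filter => /andP[_ /reps_sub[]].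
- by move=> c; rewrite mem_filter => /andP[].
- move=> c c'; rewrite !mem_filter => /andP[_ /reps_sub[cS _ tc]].
  move=> /andP[_ /reps_sub[c'S _ tc']]; apply: contraNN => cc'.
  by rewrite -tc -tc' (tp_eq cS c'S).
Qed.

End Blocks.

Lemma surj_seq (s s' : seq nat) : uniq s -> size s' <= size s -> s' != [::] ->
  exists f : nat -> nat, (forall x, x \in s -> f x \in s') /\
    forall z, z \in s' -> exists2 x, x \in s & f x = z.
Proof.
case: s' => // y0 s'; set t := y0 :: s' => us ss _.
(* Surplus positions of [s] are sent to the default [y0], which lies in the target. *)
exists (fun x => nth y0 t (index x s)); split=> [x xs|z zt].
  have [h|h] := ltnP (index x s) (size t); first exact: mem_nth.
  by rewrite nth_default// mem_head.
have iz : index z t < size s by apply: leq_trans ss; rewrite index_mem.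
by exists (nth 0 s (index z t)); rewrite ?mem_nth// index_uniq// nth_index.
Qed.

(** * Maps between blocks and their gluing *)

Section BlockMaps.
Variables (k : nat) (p q : piece).
Hypotheses (hp : forest k p) (hq : forest k q).

(* [h] either reduces the forests below the two clusters or collapses the
   lower part of the second block into a reflexive cluster of the first. *)
Lemma block_map c c' (h : nat -> nat) :
  c \in reps p -> c' \in reps q -> p.1 c c = q.1 c' c' ->
  size (cluster p c) <= size (cluster q c') ->
  (forall x, x \in below q c' -> h x \in block p c /\ p.1 (h x) c) ->
  {in below q c' &, forall x y, q.1 x y -> p.1 (h x) (h y)} ->
  (forall x z, x \in below q c' -> z \in below p c -> p.1 (h x) z ->
     exists2 y, y \in below q c' & q.1 x y /\ h y = z) ->
  exists f, [/\ forall x, x \in block q c' -> f x \in block p c,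
    {in block q c' &, forall x y, q.1 x y -> p.1 (f x) (f y)},
    forall x z, x \in block q c' -> z \in p.2 -> p.1 (f x) z ->
      exists2 y, y \in block q c' & q.1 x y /\ f y = z,
    forall z, z \in cluster p c -> exists2 x, x \in block q c' & f x = z &
    forall x, x \in below q c' -> f x = h x].
Proof.
move=> cr c'r Rcc szc h1 h2 h3.
have [cS _ _] := reps_sub hp cr; have [c'S _ _] := reps_sub hq c'r.
(* Any surjection between the top clusters will do; one exists by comparison of sizes. *)
have [||g [g1 g2]] := @surj_seq (cluster q c') (cluster p c) _ szc.
- by case: hq => uS _ _ _; apply: filter_uniq.
- by have := mem_cluster cS; case: (cluster p c).
pose f x := if x \in below q c' then h x else g x.
have fb x : x \in below q c' -> f x = h x by rewrite /f => ->.
have fc x : x \in cluster q c' -> f x = g x.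
  by move=> /cluster_below /negbTE; rewrite /f => ->.
have fB x : x \in block q c' -> f x \in block p c.
  move=> /block_split[xc|xb]; last by rewrite fb//; case: (h1 _ xb).
  by rewrite fc//; apply: cluster_block; apply: g1.
have toC x y : x \in below q c' -> y \in cluster p c -> p.1 (h x) y.
  move=> xb yc; have [hxB hxc] := h1 _ xb.
  move: hxB yc; rewrite !mem_filter => /andP[_ hxS] /andP[cy yS].
  case/predU1P: cy => [->//|/andP[_ cy]].
  by case: hp => _ tr _ _; apply: (tr _ c).
exists f; split=> //.
- move=> x y xB yB xy; have [xc|xb] := block_split xB.
    have [cc yc] := cluster_refl hq c'S xc yB xy.
    by apply: (cluster_rel hp cS); rewrite ?Rcc ?fB// fc// g1.
  have [yc|yb] := block_split yB; first by rewrite fb// fc// toC// g1.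
  by rewrite !fb//; apply: h2.
- move=> x z xB zS fxz.
  have zB : z \in block p c by apply: (block_closed hp cr (fB _ xB)).
  have [xc|xb] := block_split xB.
    have [cc zc] : p.1 c c /\ z \in cluster p c.
      by apply: (cluster_refl hp cS _ zB fxz); rewrite fc// g1.
    have [y yc gy] := g2 _ zc; exists y; first exact: cluster_block.
    by rewrite fc//; split=> //; apply: (cluster_rel hq c'S); rewrite -?Rcc.
  have [zc|zb] := block_split zB.
    have [y yc gy] := g2 _ zc; exists y; first exact: cluster_block.
    by rewrite fc//; split=> //; apply: (below_rel hq c'S).
  rewrite fb// in fxz; have [y yb [xy hy]] := h3 _ _ xb zb fxz.
  by exists y; [apply: below_block|rewrite fb].
- move=> z zc; have [y yc gy] := g2 _ zc; exists y; first exact: cluster_block.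
  by rewrite fc.
Qed.

(** The constant map to [c] serves as [h]: the reflexive [c] sees nothing properly below it, so the
    back condition on [h] is void. *)
Lemma block_collapse c c' :
  c \in reps p -> c' \in reps q -> p.1 c c -> q.1 c' c' ->
  size (cluster p c) <= size (cluster q c') ->
  exists f, [/\ forall x, x \in block q c' -> f x \in block p c,
    {in block q c' &, forall x y, q.1 x y -> p.1 (f x) (f y)} &
    forall x z, x \in block q c' -> z \in p.2 -> p.1 (f x) z ->
      exists2 y, y \in block q c' & q.1 x y /\ f y = z].
Proof.
move=> cr c'r cc c'c' szc; have [cS _ _] := reps_sub hp cr.
have [||||x z _ + cz|f [h1 h2 h3 _ _]] := @block_map c c' (fun=> c) cr c'r.
- by rewrite cc c'c'.
- by [].
- by move=> x _; rewrite mem_filter eqxx cS.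
- by [].
- by rewrite mem_filter cz andbF.
- by exists f.
Qed.

Lemma block_reduction c c' :
  c \in reps p -> c' \in reps q -> p.1 c c = q.1 c' c' ->
  size (cluster p c) <= size (cluster q c') ->
  red (p.1, below p c) (q.1, below q c') ->
  exists f, [/\ forall x, x \in block q c' -> f x \in block p c,
    {in block q c' &, forall x y, q.1 x y -> p.1 (f x) (f y)},
    forall x z, x \in block q c' -> z \in p.2 -> p.1 (f x) z ->
      exists2 y, y \in block q c' & q.1 x y /\ f y = z &
    forall z, z \in block p c -> exists2 x, x \in block q c' & f x = z].
Proof.
move=> cr c'r Rcc szc [h [/= hB honto hfwd hbck]].
have [//|//|x xb|||f [h1 h2 h3 h4 h5]] := @block_map c c' h cr c'r.
- have hb := hB _ xb; split; first exact: below_block.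
  by move: hb; rewrite mem_filter => /andP[/andP[]].
- by move=> x y; apply: hfwd.
- by move=> x z; apply: hbck.
exists f; split=> // z /block_split[/h4//|/honto[x xb hx]].
by exists x; [apply: below_block|rewrite h5].
Qed.

(** No point sees a point of another block, so maps chosen block by block form a reduction. Several
    blocks of [q] may go to one block of [p], provided that one of them covers it. *)
Lemma glue_blocks (F : nat -> nat -> nat) (g : nat -> nat) :
  (forall c, c \in reps q -> [/\ g c \in reps p,
    forall x, x \in block q c -> F c x \in block p (g c),
    {in block q c &, forall x y, q.1 x y -> p.1 (F c x) (F c y)} &
    forall x z, x \in block q c -> z \in p.2 -> p.1 (F c x) z ->
      exists2 y, y \in block q c & q.1 x y /\ F c y = z]) ->
  (forall c, c \in reps p -> exists2 c', c' \in reps q &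
    forall z, z \in block p c -> exists2 x, x \in block q c' & F c' x = z) ->
  red p q.
Proof.
move=> Fg honto; exists (fun x => F (tp q x) x).
have blk x : x \in q.2 -> x \in block q (tp q x).
  by move=> xS; rewrite (mem_block hq) ?xS/= ?eqxx// (mem_reps xS).
have blkE c x : c \in reps q -> x \in block q c -> x \in q.2 /\ tp q x = c.
  by move=> cr; rewrite (mem_block hq)// => /andP[? /eqP].
split=> /=.
- move=> x xS; have [_ h _ _] := Fg _ (mem_reps xS).
  by have := h _ (blk _ xS); rewrite mem_filter => /andP[].
- move=> z zS; have [c' c'r h] := honto _ (mem_reps zS).
  have [|x xB fx] := h z; first by rewrite (mem_block hp) ?zS/= ?eqxx// (mem_reps zS).
  by have [xS tx] := blkE _ _ c'r xB; exists x; rewrite ?tx.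
- move=> x y xS yS xy; have [_ _ h _] := Fg _ (mem_reps xS).
  have e := tp_eq hq xS yS xy; rewrite -e; apply: h => //; first exact: blk.
  by rewrite e; apply: blk.
- move=> x z xS zS fxz; have [_ _ _ h] := Fg _ (mem_reps xS).
  have [y yB [xy fy]] := h _ _ (blk _ xS) zS fxz.
  by have [yS ty] := blkE _ _ (mem_reps xS) yB; exists y; rewrite ?ty.
Qed.

End BlockMaps.

(** * Reduction well-quasi-orders forests of bounded depth *)

Definition pointed : Type := (piece * nat)%type.

Definition block_le (b b' : pointed) : Prop :=
  [/\ b.1.1 b.2 b.2 = b'.1.1 b'.2 b'.2,
      size (cluster b.1 b.2) <= size (cluster b'.1 b'.2) &
      red (b.1.1, below b.1 b.2) (b'.1.1, below b'.1 b'.2)].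

Definition refl_reps (p : piece) : seq nat := [seq c <- reps p | p.1 c c].
Definition irrefl_reps (p : piece) : seq nat := [seq c <- reps p | ~~ p.1 c c].

(** Gives the size of the reflexive top cluster onto which surplus blocks collapse; [mu] is
    arbitrary on pieces without such a cluster. *)
Definition least_cluster (mu : piece -> nat) : Prop :=
  forall p c, c \in refl_reps p -> mu p <= size (cluster p c) /\
    exists2 c0, c0 \in refl_reps p & size (cluster p c0) = mu p.

Lemma least_cluster_ex : exists mu, least_cluster mu.
Proof.
suff /choice[mu hmu] p : exists m, forall c, c \in refl_reps p ->
    m <= size (cluster p c) /\
    exists2 c0, c0 \in refl_reps p & size (cluster p c0) = m by exists mu.
case E : (refl_reps p) => [|c0 l]; first by exists 0.
pose Q m := has (fun c => size (cluster p c) == m) (refl_reps p).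
have exQ : exists m, Q m.
  exists (size (cluster p c0)); apply/hasP; exists c0; rewrite ?eqxx//.
  by rewrite E mem_head.
case: (ex_minnP exQ) => m /hasP[c1 c1r /eqP szc] hm; rewrite -E.
exists m => c cr; split; last by exists c1.
by apply: hm; apply/hasP; exists c.
Qed.

(** Equal numbers of irreflexive representatives leave no irreflexive block unmatched. The
    conditions on [nilp] and [mu] provide, for unmatched reflexive blocks, a cluster of no greater
    size to collapse onto. *)
Definition piece_le (mu : piece -> nat) (p q : piece) : Prop :=
  [/\ emb block_le (map (pair p) (refl_reps p)) (map (pair q) (refl_reps q)),
      emb block_le (map (pair p) (irrefl_reps p)) (map (pair q) (irrefl_reps q)),
      size (irrefl_reps p) = size (irrefl_reps q),
      nilp (refl_reps p) = nilp (refl_reps q) &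
      mu p <= mu q].

Lemma piece_le_red k mu p q : forest k p -> forest k q -> least_cluster mu ->
  piece_le mu p q -> red p q.
Proof.
move=> hp hq hmu [er ei si sr mupq].
have ur : uniq (refl_reps q) by rewrite filter_uniq// undup_uniq.
have ui : uniq (irrefl_reps q) by rewrite filter_uniq// undup_uniq.
have [h [h1 h2 _]] := emb_map_matching ur er.
have [h' [h'1 h'2 h'3]] := emb_map_matching ui ei.
have rP r c : c \in refl_reps r -> c \in reps r /\ r.1 c c.
  by rewrite mem_filter => /andP[].
have iP r c : c \in irrefl_reps r -> c \in reps r /\ ~~ r.1 c c.
  by rewrite mem_filter => /andP[].
pose good c' c f := [/\ c \in reps p,
    forall x, x \in block q c' -> f x \in block p c,
    {in block q c' &, forall x y, q.1 x y -> p.1 (f x) (f y)} &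
    forall x z, x \in block q c' -> z \in p.2 -> p.1 (f x) z ->
      exists2 y, y \in block q c' & q.1 x y /\ f y = z].
pose onto c' c (f : nat -> nat) :=
  forall z, z \in block p c -> exists2 x, x \in block q c' & f x = z.
(* Each block of [q] gets a target block and a map, which covers the target if the blocks are
   matched. *)
have /choice[gF hgF] c' : exists gf : nat * (nat -> nat), c' \in reps q ->
    [/\ good c' gf.1 gf.2,
        c' \in refl_reps q -> forall c, h c' = Some c -> onto c' c gf.2 &
        c' \in irrefl_reps q -> forall c, h' c' = Some c -> onto c' c gf.2].
  have [c'r|] := boolP (c' \in reps q); last by exists (0, id).
  case rc' : (q.1 c' c').
    have c'rr : c' \in refl_reps q by rewrite mem_filter rc'.
    have c'ni : (c' \in irrefl_reps q) = false by rewrite mem_filter rc'.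
    case E : (h c') => [c|].
      have [_ /rP[cr _] [/= rc szc rd]] := h1 _ _ E.
      have [f [f1 f2 f3 f4]] := block_reduction hp hq cr c'r rc szc rd.
      by exists (c, f) => _; split=> //=; [move=> _ ? [<-]|rewrite c'ni].
    (* An unmatched reflexive block collapses onto a smallest reflexive top cluster of [p]. *)
    have [c0 c0r] : exists c0, c0 \in refl_reps p.
      case E' : (refl_reps p) => [|c0 l]; last by exists c0; rewrite mem_head.
      by move: sr c'rr; rewrite E' => /esym/nilP ->.
    have [_ [c /rP[cr cc] szc]] := hmu _ _ c0r.
    have [muq _] := hmu _ _ c'rr.
    have [|f [f1 f2 f3]] := block_collapse hp hq cr c'r cc rc'.
      by rewrite szc; apply: leq_trans muq.
    by exists (c, f) => _; split=> //=; rewrite c'ni.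
  have c'ii : c' \in irrefl_reps q by rewrite mem_filter rc'.
  have c'nr : (c' \in refl_reps q) = false by rewrite mem_filter rc'.
  case E : (h' c') => [c|]; last by case: (h'3 si _ c'ii).
  have [_ /iP[cr _] [/= rc szc rd]] := h'1 _ _ E.
  have [f [f1 f2 f3 f4]] := block_reduction hp hq cr c'r rc szc rd.
  by exists (c, f) => _; split=> //=; [rewrite c'nr|move=> _ ? [<-]].
apply: (@glue_blocks k p q hp hq (fun c => (gF c).2) (fun c => (gF c).1)).
  by move=> c /hgF[].
move=> c cr; case rc : (p.1 c c).
  have [|c' c'r hc'] := h2 c; first by rewrite mem_filter rc.
  have [c'r' _] := rP _ _ c'r; exists c' => //.
  by have [_ H _] := hgF _ c'r'; apply: H.
have [|c' c'r hc'] := h'2 c; first by rewrite mem_filter rc.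
have [c'r' _] := iP _ _ c'r; exists c' => //.
by have [_ _ H] := hgF _ c'r'; apply: H.
Qed.

(** Blocks are compared through the pieces below their top clusters, which have smaller depth;
    Higman's lemma then orders the lists of blocks. *)
Lemma forest_wqo k d : wqo (fun p => forest k p /\ down_depth d p) red.
Proof.
elim: d => [|d IH] s Ps.
  (* Pieces of depth 0 are empty. *)
  exists 0, 1; split=> //; have [_ /= e0] := Ps 0; have [_ /= e1] := Ps 1.
  by exists id; rewrite /pmorphism /= e0 e1.
pose P p := forest k p /\ down_depth d.+1 p.
pose PB (b : pointed) := P b.1 /\ b.2 \in b.1.2.
have wB : wqo PB block_le.
  have w1 : wqo PB (fun b b' => b.1.1 b.2 b.2 = b'.1.1 b'.2 b'.2 :> nat).
    by apply: wqo_map (@wqo_eq_bounded 1) _ => b _; case: (b.1.1 _ _).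
  have w2 : wqo PB (fun b b' =>
      size (cluster b.1 b.2) <= size (cluster b'.1 b'.2)).
    by apply: wqo_map wqo_leq _.
  have w3 : wqo PB (fun b b' =>
      red (b.1.1, below b.1 b.2) (b'.1.1, below b'.1 b'.2)).
    apply: (wqo_map (g := fun b : pointed => (b.1.1, below b.1 b.2)) IH).
    by move=> [p c] /= [[hf hd] /hd]; split=> //; apply: forest_below.
  move=> u Pu; have [i [j [ij [[e1 e2] e3]]]] := wqo_and (wqo_and w1 w2) w3 Pu.
  by exists i, j; split=> //; split=> //; move: e1; do 2 case: (_.1.1 _ _).
have [mu hmu] := least_cluster_ex.
have PBl p (l : seq nat) : P p -> {subset l <= p.2} ->
    all_in PB (map (pair p) l).
  move=> Pp; elim: l => //= c l IHl lp; split.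
    by split=> //; apply: lp; rewrite mem_head.
  by apply: IHl => x xl; apply: lp; rewrite in_cons xl orbT.
have repsS p : P p -> {subset reps p <= p.2}.
  by move=> [hf _] c /(reps_sub hf)[].
have w1 : wqo P (fun p q => emb block_le (map (pair p) (refl_reps p))
    (map (pair q) (refl_reps q))).
  apply: (wqo_map (g := fun p : piece => map (pair p) (refl_reps p)) (higman wB)).
  move=> p Pp; apply: PBl => // c; rewrite mem_filter => /andP[_].
  exact: repsS.
have w2 : wqo P (fun p q => emb block_le (map (pair p) (irrefl_reps p))
    (map (pair q) (irrefl_reps q))).
  apply: (wqo_map (g := fun p : piece => map (pair p) (irrefl_reps p)) (higman wB)).
  move=> p Pp; apply: PBl => // c; rewrite mem_filter => /andP[_].
  exact: repsS.
have w3 : wqo P (fun p q => size (irrefl_reps p) = size (irrefl_reps q)).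
  by apply: wqo_map (@wqo_eq_bounded k) _ => p [hf _]; apply: irr_reps.
have w4 : wqo P (fun p q => nilp (refl_reps p) = nilp (refl_reps q) :> nat).
  by apply: wqo_map (@wqo_eq_bounded 1) _ => p _; case: (nilp _).
have w5 : wqo P (fun p q => mu p <= mu q) by apply: wqo_map wqo_leq _.
have [i [j [ij [[[[e1 e2] e3] e4] e5]]]] :=
  wqo_and (wqo_and (wqo_and (wqo_and w1 w2) w3) w4) w5 Ps.
exists i, j; split=> //; have [hi _] := Ps i; have [hj _] := Ps j.
apply: (piece_le_red hi hj hmu); split=> //.
by move: e4; do 2 case: (nilp _).
Qed.

(** * Rooted frames *)

Definition upper (p : piece) (r : nat) : seq nat :=
  [seq x <- p.2 | ~~ ((x == r) || p.1 x r)].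
Definition root_cluster (p : piece) (r : nat) : seq nat :=
  [seq x <- p.2 | (x == r) || p.1 x r].

Definition rooted (k n : nat) (b : pointed) : Prop :=
  let: (p, r) := b in
  [/\ uniq p.2, r \in p.2, forall x, x \in p.2 -> x = r \/ p.1 r x,
      {in p.2 & &, forall x y z, p.1 x y -> p.1 y z -> p.1 x z} &
      forest k (p.1, upper p r) /\ down_depth n (p.1, upper p r)].

Lemma root_sees k n p r x y : rooted k n (p, r) -> x \in root_cluster p r ->
  y \in upper p r -> p.1 x y.
Proof.
move=> [_ rS rr tr _]; rewrite !mem_filter => /andP[xr xS] /andP[yr yS].
have ry : p.1 r y by case: (rr _ yS) => // e; rewrite e eqxx in yr.
by case/predU1P: xr => [->//|xr]; apply: (tr _ r).
Qed.

Lemma root_cluster_rel k n p r x y : rooted k n (p, r) -> p.1 r r ->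
  x \in root_cluster p r -> y \in root_cluster p r -> p.1 x y.
Proof.
move=> [_ rS rr tr _] prr; rewrite !mem_filter => /andP[xr xS] /andP[yr yS].
have ry : p.1 r y by case: (rr _ yS) => [->|].
by case/predU1P: xr => [->//|xr]; apply: (tr _ r).
Qed.

Lemma root_cluster_refl k n p r x y : rooted k n (p, r) ->
  x \in root_cluster p r -> y \in root_cluster p r -> p.1 x y -> p.1 r r.
Proof.
move=> [_ rS rr tr _]; rewrite !mem_filter => /andP[xr xS] /andP[yr yS] xy.
have yr' : y = r \/ p.1 y r by case/predU1P: yr; [left|right].
have xr' : p.1 x r by case: yr' => [<-//|]; apply: tr xy.
by case: (rr _ xS) => [e|rx]; [rewrite -{1}e|apply: (tr _ x)].
Qed.

(** The root cluster sees all of the upper part, so a reduction of the upper parts extends by any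
    surjection of root clusters. For root points, the back condition comes from surjectivity
    above. *)
Lemma rooted_red k n p r q r' : rooted k n (p, r) -> rooted k n (q, r') ->
  p.1 r r = q.1 r' r' ->
  size (root_cluster p r) <= size (root_cluster q r') ->
  red (p.1, upper p r) (q.1, upper q r') -> red p q.
Proof.
move=> hp hq Rrr szr [h [/= hU honto hfwd hbck]].
case: (hp) => [up rS pr trp _]; case: (hq) => [uq r'S qr trq _].
have [|//||g [g1 g2]] := @surj_seq (root_cluster q r') (root_cluster p r).
- exact: filter_uniq.
- have : r \in root_cluster p r by rewrite mem_filter eqxx.
  by case: (root_cluster p r).
have splitS b s x : x \in b.2 -> x \in root_cluster b s \/ x \in upper b s.
  by move=> xS; rewrite !mem_filter xS !andbT; case: (_ || _); [left|right].
have upC b s x : x \in upper b s -> x \notin root_cluster b s.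
  by rewrite !mem_filter => /andP[/negbTE-> _].
have upS b s : {subset upper b s <= b.2}.
  by move=> x; rewrite mem_filter => /andP[].
have clS b s : {subset root_cluster b s <= b.2}.
  by move=> x; rewrite mem_filter => /andP[].
have up_closed k' n' b s x y : rooted k' n' (b, s) -> x \in upper b s ->
    y \in b.2 -> b.1 x y -> y \in upper b s.
  move=> [_ sS _ tr _]; rewrite !mem_filter => /andP[nx xS] yS xy.
  rewrite yS andbT; apply: contra nx => /predU1P[<-|ys]; first by rewrite xy orbT.
  by rewrite (tr x y s xS yS sS xy ys) orbT.
pose f x := if x \in root_cluster q r' then g x else h x.
have fc x : x \in root_cluster q r' -> f x = g x by rewrite /f => ->.
have fu x : x \in upper q r' -> f x = h x by move/upC/negbTE; rewrite /f => ->.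
exists f; split=> /=.
- move=> x /splitS-/(_ r')[xc|xu]; first by rewrite fc//; apply: clS (g1 _ xc).
  by rewrite fu//; apply: upS (hU _ xu).
- move=> z /splitS-/(_ r)[/g2[x xc gx]|/honto[x xu hx]].
    by exists x; [apply: clS xc|rewrite fc].
  by exists x; [apply: upS xu|rewrite fu].
- move=> x y xS yS xy.
  have [xc|xu] := splitS _ r' _ xS; have [yc|yu] := splitS _ r' _ yS.
  + rewrite !fc//; apply: (root_cluster_rel hp); rewrite ?g1// Rrr.
    exact: (root_cluster_refl hq xc yc xy).
  + by rewrite fc// fu//; apply: (root_sees hp); [apply: g1|apply: hU].
  + by have := upC _ _ _ (up_closed _ _ _ _ _ _ hq xu yS xy); rewrite yc.
  + by rewrite !fu//; apply: hfwd.
- move=> x z xS zS fxz; have [xc|xu] := splitS _ r' _ xS.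
    rewrite fc// in fxz; have [zc|zu] := splitS _ r _ zS.
      have [y yc gy] := g2 _ zc; exists y; first exact: clS yc.
      rewrite fc//; split=> //; apply: (root_cluster_rel hq) => //.
      by rewrite -Rrr; apply: (root_cluster_refl hp (g1 _ xc) zc fxz).
    have [y yu hy] := honto _ zu; exists y; first exact: upS yu.
    by rewrite fu//; split=> //; apply: (root_sees hq).
  rewrite fu// in fxz.
  have zu := up_closed _ _ _ _ _ _ hp (hU _ xu) zS fxz.
  have [y yu [xy hy]] := hbck _ _ xu zu fxz.
  by exists y; [apply: upS yu|rewrite fu].
Qed.

Lemma rooted_wqo k n : wqo (rooted k n) (fun b b' => red b.1 b'.1).
Proof.
have w1 : wqo (rooted k n) (fun b b' => b.1.1 b.2 b.2 = b'.1.1 b'.2 b'.2 :> nat).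
  by apply: wqo_map (@wqo_eq_bounded 1) _ => b _; case: (b.1.1 _ _).
have w2 : wqo (rooted k n) (fun b b' =>
    size (root_cluster b.1 b.2) <= size (root_cluster b'.1 b'.2)).
  by apply: wqo_map wqo_leq _.
have w3 : wqo (rooted k n) (fun b b' =>
    red (b.1.1, upper b.1 b.2) (b'.1.1, upper b'.1 b'.2)).
  apply: (wqo_map (g := fun b : pointed => (b.1.1, upper b.1 b.2))
    (@forest_wqo k n)).
  by move=> [p r] [].
move=> s Ps; have [i [j [ij [[e1 e2] e3]]]] := wqo_and (wqo_and w1 w2) w3 Ps.
exists i, j; split=> //.
move: (Ps i) (Ps j) e1 e2 e3; case: (s i) (s j) => [p r] [q r'] /= hp hq e1 e2 e3.
apply: (rooted_red hp hq _ e2 e3).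
by move: e1; do 2 case: (_.1 _ _).
Qed.

(** The chain descends from [c 0], with the same numbering as in [not_depth_le], so that the two
    notions of depth can be compared. *)
Lemma not_down_depth d p : ~ down_depth d p ->
  exists c : nat -> nat, (forall i, i <= d -> c i \in p.2) /\
    forall i, i < d -> strict p.1 (c i.+1) (c i).
Proof.
elim: d p => [|d IH] [R S] /= h.
  case: S h => [//|x S] _; exists (fun=> x); split=> // i _; exact: mem_head.
have [x /not_implyP[xS /IH[/= c [c1 c2]]]] := (existsNP _).2 h.
have cS i : i <= d -> [/\ c i \in S, R (c i) x & ~ R x (c i)].
  by move=> /c1; rewrite mem_filter => /andP[/andP[? /negP ?] ?].
exists (fun i => if i is i'.+1 then c i' else x); split=> [[|i]//|[|i] hi].
- by move=> hi; case: (cS i hi).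
- by have [_ ? ?] := cS 0 isT.
- exact: c2.
Qed.

Lemma depth_le_chain (T : Type) (R : T -> T -> Prop) (c : nat -> T) d :
  depth_le R d (c d) -> (forall i, i < d -> strict R (c i.+1) (c i)) -> False.
Proof.
elim: d => [//|d IH] /= h hc; apply: IH; first by apply: h; apply: hc.
by move=> i hi; apply: hc; apply: ltnW.
Qed.

(** * Conditions that the axioms impose on finite frames *)

Section FrameConditions.
Variables (N : nat) (R : rel nat).
Hypothesis RN : forall x y, R x y -> x < N /\ y < N.
Local Notation vld := (valid [set x | x < N] R).

Lemma valid_ax4 : vld ax4 -> forall x y z, R x y -> R y z -> R x z.
Proof.
move=> v4 x y z xy yz; have [xN _] := RN xy.
by apply: (v4 (fun i w => R x w) x xN _ y xy z yz).
Qed.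

Lemma valid_widPlus r x y z : vld (axWidPlus 1) ->
  R r x -> ~~ R x r -> R r y -> R r z -> R x y -> R x z ->
  [\/ y = z, R y z | R z y].
Proof.
move=> vW rx nxr ry rz xy xz; have [rN _] := RN rx.
(* [q] holds only at the root [r], which [x] does not see; [p_0] and [p_1] hold only at [y] and
   [z]. *)
pose V i w := if i is i'.+1 then w = nth r [:: y; z] i' else w = r.
have {}vW : sat R V (And qvar (Dia (And (Box (Neg qvar))
    (\big[And/Top]_(i < 2) Dia (pvar i))))) r -> sat R V (wid_concl 1) r.
  exact: vW.
have : sat R V (wid_concl 1) r.
  apply: vW; apply/sat_And; split=> //; apply/sat_Dia; exists x; split=> //.
  apply/sat_And; split=> [w /= xw wr|]; first by rewrite -wr xw in nxr.
  apply/sat_bigAnd => -[[|[|//]] ?] _; apply/sat_Dia; [exists y|exists z] => //.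
case/sat_bigOr => -[i iN] [_ _] /sat_bigOr[[j jN] [_ ij]].
move/sat_Dia => [w [_ /sat_And[wi /sat_Or wj]]].
move: wi wj ij.
case: i iN => [|[|//]] ?; case: j jN => [|[|//]] ? // wi [wj|/sat_Dia[v [wv vj]]] _.
- by constructor 1; rewrite -[y]wi -[z]wj.
- by constructor 2; rewrite -[y]wi -[z]vj.
- by constructor 1; rewrite -[y]wj -[z]wi.
- by constructor 3; rewrite -[y]vj -[z]wi.
Qed.

Lemma valid_widBullet k r s : vld (axWidBullet k) -> uniq s -> r < N ->
  (forall x, x \in s -> R r x) -> (forall x, x \in s -> ~~ R x x) ->
  {in s &, forall x y, x != y -> ~~ R x y} -> size s <= k.
Proof.
move=> vW us rN rs irr anti; rewrite leqNgt; apply/negP => ks.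
(* For [i <= k], [p_i] holds only at the [i]-th point of [s], which is irreflexive and so does not
   see it. *)
pose V i w := if i is i'.+1 then w = nth 0 s i' else False.
have {}vW : sat R V (\big[And/Top]_(i < k.+1)
    Dia (And (pvar i) (Box (Neg (pvar i))))) r -> sat R V (wid_concl k) r.
  exact: vW.
have sI (i : 'I_k.+1) : nth 0 s i \in s.
  by apply: mem_nth; apply: leq_trans ks; apply: ltn_ord.
have : sat R V (wid_concl k) r.
  apply: vW; apply/sat_bigAnd => i _; apply/sat_Dia; exists (nth 0 s i).
  split; first exact/rs/sI.
  apply/sat_And; split=> //= w iw wi; have := irr _ (sI i).
  by rewrite -{2}wi iw.
case/sat_bigOr => i [_ _] /sat_bigOr[j [_ ij]].
have nij : nth 0 s i != nth 0 s j.
  by rewrite nth_uniq//; apply: leq_trans ks; apply: ltn_ord.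
move/sat_Dia => [w [_ /sat_And[wi /sat_Or[wj|/sat_Dia[v [wv vj]]]]]].
  by move: nij; rewrite -[nth 0 s i]wi -[nth 0 s j]wj eqxx.
by have := anti _ _ (sI i) (sI j) nij; rewrite -[nth 0 s i]wi -[nth 0 s j]vj wv.
Qed.

Lemma frame_rooted n k r : 0 < n -> r < N ->
  vld ax4 -> vld (axB n) -> vld (axWidPlus 1) -> vld (axWidBullet k) ->
  rooted k n (R, [seq x <- iota 0 N | (x == r) || R r x], r).
Proof.
move=> n0 rN v4 vB vW1 vWk; have tr := valid_ax4 v4.
set D := [seq x <- _ | _].
have uD : uniq D by rewrite filter_uniq// iota_uniq.
have UP x : x \in upper (R, D) r -> R r x /\ ~~ R x r.
  rewrite !mem_filter negb_or /= => /and3P[/andP[xr nxr] + _].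
  by rewrite (negbTE xr).
split=> //=.
- by rewrite mem_filter eqxx mem_iota.
- by move=> x; rewrite mem_filter => /andP[/predU1P[]]; [left|right].
- by move=> x y z _ _ _; apply: tr.
split; first split=> /=.
- exact: filter_uniq.
- by move=> x y z _ _ _; apply: tr.
- move=> x y z /UP[rx nxr] /UP[ry _] /UP[rz _].
  exact: valid_widPlus rx nxr ry rz.
- move=> s us sU irr anti; apply: (valid_widBullet vWk us rN) => // x /sU.
  by case/UP.
(* A strict chain of [n.+1] points would contradict the depth of its lowest point [c n]. *)
apply: contrapT => /not_down_depth[c [_ hc]].
have Dcl x y : x < N -> R x y -> y < N by move=> _ /RN[].
apply: (@depth_le_chain _ R c n _ hc); apply: (valid_depth n0 Dcl vB).
by case: n n0 hc {vB} => // n _ /(_ n (ltnSn n))[/RN[]].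
Qed.

End FrameConditions.

(** * Finite axiomatizability *)

Section FiniteAxiomatizability.
Variables (n k : nat).
Hypothesis n0 : 0 < n.

Definition base_axioms : seq form := [:: ax4; axB n; axWidPlus 1; axWidBullet k].

Lemma extension_base (L : set form) :
  extension_of (oplus (logicK4B n) [set axWidPlus 1; axWidBullet k]) L ->
  forall a, List.In a base_axioms -> L a.
Proof.
move=> [_ sub] a ha; apply: sub.
case: ha => [<-|[<-|[<-|[<-|//]]]].
- apply: sub_gen_smallest; left; apply: sub_gen_smallest; left.
  exact: sub_gen_smallest.
- by apply: sub_gen_smallest; left; apply: sub_gen_smallest; right.
- by apply: sub_gen_smallest; right; left.
- by apply: sub_gen_smallest; right; right.
Qed.

(** The finite model is cut down to the subframe generated by a refuting point. *)
Lemma refuting_frame (L : set form) a : modal_logic L ->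
  (forall b, List.In b base_axioms -> L b) -> ~ L a ->
  exists b : pointed, [/\ rooted k n b,
    forall x y, x \in b.1.2 -> b.1.1 x y -> y \in b.1.2,
    L `<=` valid [set x | x \in b.1.2] b.1.1 &
    ~ valid [set x | x \in b.1.2] b.1.1 a].
Proof.
move=> hL Lb nLa.
have [L4 LB LW1 LWk] : [/\ L ax4, L (axB n), L (axWidPlus 1) & L (axWidBullet k)].
  by split; apply: Lb => /=; auto.
have [N [R [_ RN LV nVa]]] := finite_model_property hL L4 n0 LB nLa (leqnn _).
have [V /existsNP[r /not_implyP[/= rN nra]]] := (existsNP _).2 nVa.
have hr := frame_rooted RN n0 rN (LV _ L4) (LV _ LB) (LV _ LW1) (LV _ LWk).
exists (R, [seq x <- iota 0 N | (x == r) || R r x], r); split=> //=.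
- move=> x y; rewrite !mem_filter !mem_iota !add0n /= => /andP[xr _] xy.
  have [_ ->] := RN _ _ xy; rewrite andbT.
  case/predU1P: xr => [<-|rx]; first by rewrite xy orbT.
  by rewrite (valid_ax4 RN (LV _ L4) rx xy) orbT.
- move=> c /LV vc W x /=; rewrite mem_filter mem_iota add0n => /andP[_ xN].
  exact: vc.
- by move=> va; apply: nra; apply: va; rewrite /= mem_filter eqxx mem_iota.
Qed.

(** The base axioms are kept in [D], so that every logic on the way has refuting frames of the
    well-quasi-ordered kind and the final one is open to the decision procedure. *)
Lemma extension_finitely_axiomatized (L : set form) : modal_logic L ->
  (forall b, List.In b base_axioms -> L b) ->
  exists D : seq form, (forall b, List.In b base_axioms -> List.In b D) /\
    L = oplus logicK [set b | List.In b D].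
Proof.
move=> hL Lb; apply: contrapT => nfa.
have step (D : seq form) : (forall b, List.In b base_axioms -> List.In b D) ->
    (forall b, List.In b D -> L b) ->
    exists a, L a /\ ~ oplus logicK [set b | List.In b D] a.
  move=> bD DL; apply: contrapT => h; apply: nfa; exists D; split=> //.
  apply/seteqP; split; last exact: oplusK_sub.
  by move=> a La; apply: contrapT => na; apply: h; exists a.
pose st := {D : seq form | (forall b, List.In b base_axioms -> List.In b D) /\
  forall b, List.In b D -> L b}.
have /choice[nx hnx] (D : st) : exists a, L a /\
    ~ oplus logicK [set b | List.In b (sval D)] a.
  by case: D => D [h1 h2]; apply: step.
have cons_st (D : st) : (forall b, List.In b base_axioms -> List.In b (nx D :: sval D)) /\
    forall b, List.In b (nx D :: sval D) -> L b.
  case: (svalP D) => h1 h2; split=> [b /h1|b [<-|/h2//]]; first by right.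
  by case: (hnx D).
(* [S i] lists the base axioms and the first [i] chosen formulas of [L], each underivable from those
   before it. *)
pose S := fix S i : st :=
  if i is i'.+1 then exist _ _ (cons_st (S i')) else exist _ base_axioms (conj (fun _ => id) Lb).
pose LL i := oplus logicK [set b | List.In b (sval (S i))].
have /choice[F hF] i : exists b : pointed, [/\ rooted k n b,
    forall x y, x \in b.1.2 -> b.1.1 x y -> y \in b.1.2,
    LL i `<=` valid [set x | x \in b.1.2] b.1.1 &
    ~ valid [set x | x \in b.1.2] b.1.1 (nx (S i))].
  apply: refuting_frame; first exact: smallest_modal_logic.
    move=> b bb; apply: oplus_ax => /=; case: (svalP (S i)) => + _; exact.
  by case: (hnx (S i)).
have nxS i j : i < j -> List.In (nx (S i)) (sval (S j)).
  elim: j => // j IH; rewrite ltnS leq_eqVlt => /predU1P[->|/IH]; [left|right] => //.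
(* [F j] validates the formula that [F i] refutes, and yet is mapped onto [F i]. *)
have [i [j [ij [f hf]]]] := rooted_wqo (fun i => let: And4 h _ _ _ := hF i in h).
have [_ cli _ nvi] := hF i; have [_ clj vj _] := hF j.
apply: nvi; apply: (pmorphism_valid clj cli hf); apply: vj.
by apply: oplus_ax; apply: nxS.
Qed.

End FiniteAxiomatizability.

(** * Recursive functions *)

Local Arguments npair : simpl never.
Local Arguments nfst : simpl never.
Local Arguments nsnd : simpl never.

Lemma nfst_pair a b : nfst (npair a b) = a.
Proof. by rewrite /nfst /npair Cantor.cancel_of_to. Qed.

Lemma nsnd_pair a b : nsnd (npair a b) = b.
Proof. by rewrite /nsnd /npair Cantor.cancel_of_to. Qed.

Lemma npair_surj e : npair (nfst e) (nsnd e) = e.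
Proof.
by rewrite /nfst /nsnd /npair -surjective_pairing Cantor.cancel_to_of.
Qed.

Lemma npair_ge a b : a + b <= npair a b.
Proof. by apply/leP; rewrite addnC; apply: Cantor.to_nat_non_decreasing. Qed.

Lemma rec_ext f g : (forall e, f e = g e) -> recursive f -> recursive g.
Proof. by move=> /funext ->. Qed.

Lemma rec_id : recursive id.
Proof. exact: rec_ext npair_surj (rec_pair rec_fst rec_snd). Qed.

Lemma rec_app f g : recursive f -> recursive g -> recursive (fun e => f (g e)).
Proof. exact: rec_comp. Qed.

Lemma rec_const c : recursive (fun=> c).
Proof. by elim: c => [|c IH]; [exact: rec_zero|exact: (rec_app rec_succ IH)]. Qed.

Fixpoint primrec (x : nat) (g : nat -> nat -> nat) (n : nat) : nat :=
  if n is n'.+1 then g n' (primrec x g n') else x.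

(** Recursion with a parameter: [rec_prim] hands the step function a code of parameter, counter and
    earlier value, whence the projections. *)
Lemma rec_primrec a g b : recursive a ->
  recursive (fun z => g (nfst z) (nfst (nsnd z)) (nsnd (nsnd z))) ->
  recursive b -> recursive (fun e => primrec (a e) (g e) (b e)).
Proof.
move=> ra rg rb.
pose h z := primrec (a (nfst z)) (g (nfst z)) (nsnd z).
have rh : recursive h.
  apply: (rec_prim ra rg) => [x|x n]; first by rewrite /h nfst_pair nsnd_pair.
  by rewrite /h !nfst_pair !nsnd_pair /= nfst_pair.
apply: rec_ext (rec_app rh (rec_pair rec_id rb)) => e.
by rewrite /h nfst_pair nsnd_pair.
Qed.

(** Case distinction on zero, as a recursion that forgets the earlier value. *)
Definition cond (b x y : nat) : nat := primrec y (fun _ _ => x) b.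
Lemma condE (b : bool) x y : cond b x y = if b then x else y.
Proof. by case: b. Qed.

Ltac rec_step :=
  match goal with
  | |- recursive (fun z => z) => exact: rec_id
  | |- recursive nfst => exact: rec_fst
  | |- recursive nsnd => exact: rec_snd
  | |- recursive S => exact: rec_succ
  | |- recursive (fun=> ?c) => exact: rec_const
  | |- recursive (fun z => nfst (@?f z)) => apply: (rec_app rec_fst)
  | |- recursive (fun z => nsnd (@?f z)) => apply: (rec_app rec_snd)
  | |- recursive (fun z => (@?f z).+1) => apply: (rec_app rec_succ)
  | |- recursive (fun z => npair (@?f z) (@?g z)) => apply: rec_pair
  | |- recursive (fun z => primrec (@?a z) (@?g z) (@?b z)) =>
      apply: (@rec_primrec a g b); cbv beta
  | h : recursive ?f |- recursive ?f => exact: h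
  | h : recursive ?f |- recursive (fun z => ?f (@?g z)) => apply: (rec_app h)
  end.

Ltac rec_basic := repeat rec_step.

Section Arithmetic.
Variables (f g h : nat -> nat).
Hypotheses (rf : recursive f) (rg : recursive g) (rh : recursive h).

Lemma rec_add : recursive (fun e => f e + g e).
Proof.
apply: (@rec_ext (fun e => primrec (f e) (fun _ y => y.+1) (g e))); last by rec_basic.
by move=> e; elim: (g e) => [|n /= ->]; rewrite ?addn0 ?addnS.
Qed.

Lemma rec_pred : recursive (fun e => (f e).-1).
Proof.
apply: (@rec_ext (fun e => primrec 0 (fun n _ => n) (f e))); last by rec_basic.
by move=> e; case: (f e).
Qed.

Lemma rec_cond : recursive (fun e => cond (f e) (g e) (h e)).
Proof. by rewrite /cond; rec_basic. Qed.

End Arithmetic.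

Lemma rec_mul f g : recursive f -> recursive g -> recursive (fun e => f e * g e).
Proof.
move=> rf rg.
apply: (@rec_ext (fun e => primrec 0 (fun _ y => y + f e) (g e))).
  by move=> e; elim: (g e) => [|n /= ->]; rewrite ?muln0 ?mulnSr.
by rec_basic; apply: rec_add; rec_basic.
Qed.

Lemma rec_sub f g : recursive f -> recursive g -> recursive (fun e => f e - g e).
Proof.
move=> rf rg.
apply: (@rec_ext (fun e => primrec (f e) (fun _ y => y.-1) (g e))).
  by move=> e; elim: (g e) => [|n /= ->]; rewrite ?subn0 ?subnS.
by rec_basic; apply: rec_pred; rec_basic.
Qed.

Lemma rec_pow2 f : recursive f -> recursive (fun e => 2 ^ f e).
Proof.
move=> rf.
apply: (@rec_ext (fun e => primrec 1 (fun _ y => y + y) (f e))).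
  by move=> e; elim: (f e) => [|n /= ->]; rewrite ?expnS ?mul2n ?addnn.
by rec_basic; apply: rec_add; rec_basic.
Qed.

Lemma rec_negb (P : nat -> bool) : recursive (fun e => nat_of_bool (P e)) ->
  recursive (fun e => nat_of_bool (~~ P e)).
Proof.
move=> rP; apply: (@rec_ext (fun e => cond (P e) 0 1)).
  by move=> e; case: (P e).
by apply: rec_cond; rec_basic.
Qed.

Lemma rec_and (P Q : nat -> bool) : recursive (fun e => nat_of_bool (P e)) ->
  recursive (fun e => nat_of_bool (Q e)) ->
  recursive (fun e => nat_of_bool (P e && Q e)).
Proof.
move=> rP rQ; apply: (@rec_ext (fun e => cond (P e) (Q e) 0)).
  by move=> e; case: (P e).
by apply: rec_cond; rec_basic.
Qed.

Lemma rec_imp (P Q : nat -> bool) : recursive (fun e => nat_of_bool (P e)) ->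
  recursive (fun e => nat_of_bool (Q e)) ->
  recursive (fun e => nat_of_bool (P e ==> Q e)).
Proof.
move=> rP rQ; apply: (@rec_ext (fun e => cond (P e) (Q e) 1)).
  by move=> e; case: (P e).
by apply: rec_cond; rec_basic.
Qed.

Lemma rec_if (P Q S : nat -> bool) : recursive (fun e => nat_of_bool (P e)) ->
  recursive (fun e => nat_of_bool (Q e)) -> recursive (fun e => nat_of_bool (S e)) ->
  recursive (fun e => nat_of_bool (if P e then Q e else S e)).
Proof.
move=> rP rQ rS; apply: (@rec_ext (fun e => cond (P e) (Q e) (S e))).
  by move=> e; case: (P e).
exact: rec_cond.
Qed.

Lemma rec_nonzero f : recursive f -> recursive (fun e => nat_of_bool (f e != 0)).
Proof.
move=> rf; apply: (@rec_ext (fun e => cond (f e) 1 0)).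
  by move=> e; rewrite /cond; case: (f e).
by apply: rec_cond; rec_basic.
Qed.

Lemma rec_eqc f c : recursive f -> recursive (fun e => nat_of_bool (f e == c)).
Proof.
move=> rf; apply: (@rec_ext (fun e =>
    nat_of_bool (~~ (f e - c != 0) && ~~ (c - f e != 0)))).
  by move=> e; rewrite !negbK !subn_eq0 eqn_leq.
apply: rec_and; apply: rec_negb; apply: rec_nonzero; apply: rec_sub; rec_basic.
Qed.

(** * Bounded quantifiers, binary digits and coded lists *)

Definition ball (n : nat) (P : pred nat) : bool := all P (iota 0 n).

Lemma ballP n (P : pred nat) : reflect (forall i, i < n -> P i) (ball n P).
Proof.
apply: (iffP allP) => h i; first by move=> ni; apply: h; rewrite mem_iota.
by rewrite mem_iota => ?; apply: h.
Qed.

Lemma rec_ball b (P : nat -> pred nat) : recursive b ->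
  recursive (fun z => nat_of_bool (P (nfst z) (nsnd z))) ->
  recursive (fun e => nat_of_bool (ball (b e) (P e))).
Proof.
move=> rb rP.
apply: (@rec_ext (fun e => primrec 1 (fun i y => cond (P e i) y 0) (b e))).
  move=> e; elim: (b e) => // n /= ->.
  have -> : ball n.+1 (P e) = ball n (P e) && P e n.
    by rewrite /ball -addn1 iotaD all_cat /= andbT.
  by rewrite condE andbC; case: (P e n).
rec_basic; apply: rec_cond; rec_basic.
apply: (rec_ext _ (rec_app rP (rec_pair rec_fst (rec_app rec_fst rec_snd)))) => z /=.
by rewrite nfst_pair nsnd_pair.
Qed.

(** A number codes a finite set by its binary digits; relations and valuations are coded in this
    way. *)
Definition bit (r i : nat) : bool := odd (iter i half r).

Lemma rec_odd f : recursive f -> recursive (fun e => nat_of_bool (odd (f e))).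
Proof.
move=> rf; apply: (@rec_ext (fun e => primrec 0 (fun _ y => 1 - y) (f e))).
  by move=> e; elim: (f e) => //= n ->; case: odd.
by rec_basic; apply: rec_sub; rec_basic.
Qed.

Lemma rec_half f : recursive f -> recursive (fun e => (f e)./2).
Proof.
move=> rf; apply: (@rec_ext (fun e => primrec 0 (fun i y => odd i + y) (f e))).
  by move=> e; elim: (f e) => // n /= ->; rewrite uphalf_half.
by rec_basic; apply: rec_add; rec_basic; apply: rec_odd; rec_basic.
Qed.

Lemma rec_bit f g : recursive f -> recursive g ->
  recursive (fun e => nat_of_bool (bit (f e) (g e))).
Proof.
move=> rf rg; apply: rec_odd.
apply: (@rec_ext (fun e => primrec (f e) (fun _ y => y./2) (g e))).
  by move=> e; elim: (g e) => // n /= ->.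
by rec_basic; apply: rec_half; rec_basic.
Qed.

Lemma bits_ex (f : nat -> bool) M :
  exists2 r, r < 2 ^ M & forall i, i < M -> bit r i = f i.
Proof.
elim: M f => [|M IH] f; first by exists 0.
have [r rM hr] := IH (fun i => f i.+1).
exists (f 0 + r.*2).
  by rewrite expnS mul2n; case: (f 0); rewrite ?add0n ?ltn_double// add1n ltn_Sdouble.
case=> [_|i iM]; first by rewrite /bit /= oddD odd_double addbF oddb.
by rewrite /bit iterSr half_bit_double; apply: hr.
Qed.

(* Lists are coded in reverse by iterated pairing: the head of [ptab F n] is
   the entry of index [n.-1], which may depend on the earlier entries. *)
Definition ptab (F : nat -> nat -> nat) (n : nat) : nat :=
  primrec 0 (fun i t => npair (F i t) t) n.
(** The length [n] is an argument because entry [i] lies under the [n - i.+1] later ones. *)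
Definition get (n t i : nat) : nat :=
  nfst (primrec t (fun _ => nsnd) (n - i.+1)).

Lemma get_ptab F n i : i < n -> get n (ptab F n) i = F i (ptab F i).
Proof.
move=> ni; rewrite /get.
have -> : n = i.+1 + (n - i.+1) by rewrite subnKC.
rewrite addKn; elim: (n - i.+1) => [|d IH]; first by rewrite addn0 /ptab /= nfst_pair.
have shift t m : primrec t (fun=> nsnd) m.+1 = primrec (nsnd t) (fun=> nsnd) m.
  by elim: m => //= m ->.
by rewrite shift addnS [ptab F _.+1]/ptab /= nsnd_pair -/(ptab _ _) IH.
Qed.

Lemma rec_ptab (F : nat -> nat -> nat -> nat) b : recursive b ->
  recursive (fun z => F (nfst z) (nfst (nsnd z)) (nsnd (nsnd z))) ->
  recursive (fun e => ptab (F e) (b e)).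
Proof. by move=> rb rF; rewrite /ptab; rec_basic. Qed.

Lemma rec_get a b c : recursive a -> recursive b -> recursive c ->
  recursive (fun e => get (a e) (b e) (c e)).
Proof.
by move=> ra rb rc; rewrite /get; rec_basic; apply: rec_sub; rec_basic.
Qed.

(** * Model checking *)

(* [truth_row] is the table, over the worlds below [N], of the truth values of
   the formula coded by [c], given the tables [t] of the smaller codes. *)
Definition truth_row (N r v c t : nat) : nat :=
  ptab (fun w _ => nat_of_bool
    (if nfst c == 0 then bit v (nsnd c * N + w)
     else if nfst c == 1 then false
     else if nfst c == 2 then
       (get N (get c t (nfst (nsnd c))) w != 0) ==>
       (get N (get c t (nsnd (nsnd c))) w != 0)
     else ball N (fun u => bit r (w * N + u) ==>
                           (get N (get c t (nsnd c)) u != 0)))) N.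

(** Course-of-values recursion: the rows of all codes below [c] are tabulated first. *)
Definition check (N r v c w : nat) : bool :=
  get N (truth_row N r v c (ptab (truth_row N r v) c)) w != 0.

Definition bit_rel (N r : nat) : rel nat :=
  fun x y => [&& x < N, y < N & bit r (x * N + y)].
Definition bit_val (N v : nat) (p w : nat) : Prop := bit v (p * N + w).

Lemma checkE N r v c w : w < N -> check N r v c w =
  let t := ptab (truth_row N r v) c in
  if nfst c == 0 then bit v (nsnd c * N + w)
  else if nfst c == 1 then false
  else if nfst c == 2 then
    (get N (get c t (nfst (nsnd c))) w != 0) ==>
    (get N (get c t (nsnd (nsnd c))) w != 0)
  else ball N (fun u => bit r (w * N + u) ==> (get N (get c t (nsnd c)) u != 0)).
Proof. by move=> wN; rewrite /check {1}/truth_row get_ptab// eqb0 negbK. Qed.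

Lemma npair_gt m a : a < npair m.+1 a.
Proof. by apply: leq_trans (npair_ge _ _); rewrite addSn ltnS leq_addl. Qed.

Lemma checkP N r v a w : w < N ->
  check N r v (godel a) w <-> sat (bit_rel N r) (bit_val N v) a w.
Proof.
(* Subformulas have smaller codes, so their entries in the table are themselves values of
   [check]. *)
have subE c c' u : c' < c ->
    (get N (get c (ptab (truth_row N r v) c) c') u != 0) = check N r v c' u.
  by move=> ?; rewrite get_ptab.
elim: a w => [p||a IHa b IHb|a IHa] w wN; rewrite checkE//; cbv zeta.
- by rewrite [godel _]/(npair 0 p) nfst_pair nsnd_pair.
- have lab := npair_ge (godel a) (godel b).
  have lt2 := npair_gt 1 (npair (godel a) (godel b)).
  rewrite [godel _]/(npair 2 (npair (godel a) (godel b))) !nfst_pair !nsnd_pair.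
  rewrite !nfst_pair !subE.
  + by rewrite /= -IHa// -IHb//; split=> /implyP.
  + exact: leq_ltn_trans (leq_trans (leq_addl _ _) lab) lt2.
  + exact: leq_ltn_trans (leq_trans (leq_addr _ _) lab) lt2.
- rewrite [godel _]/(npair 3 (godel a)) nfst_pair nsnd_pair.
  have lt3 := npair_gt 2 (godel a); split.
    move=> /ballP h u /and3P[_ uN wu]; apply/IHa => //.
    by have /implyP := h u uN; rewrite subE//; apply.
  move=> h; apply/ballP => u uN; apply/implyP => wu; rewrite subE//.
  by apply/IHa => //; apply: h; apply/and3P.
Qed.

(** A formula with code [c] has no variable beyond [c], so [c.+1] rows of [N] bits cover all
    relevant valuations. *)
Definition frame_check (N r c : nat) : bool :=
  ball (2 ^ (c.+1 * N)) (fun v => ball N (fun w => check N r v c w)).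

Lemma maxvar_godel a : maxvar a <= (godel a).+1.
Proof.
elim: a => [i||a IHa b IHb|a IHa] //=.
- by rewrite ltnS; apply: leq_trans (npair_ge _ _).
- have h := leq_trans (npair_ge (godel a) (godel b)) (ltnW (npair_gt 1 _)).
  rewrite geq_max (leq_trans IHa) ?(leq_trans IHb)// ltnS.
    exact: leq_trans (leq_addl _ _) h.
  exact: leq_trans (leq_addr _ _) h.
- by apply: leq_trans IHa _; rewrite ltnS; apply: ltnW (npair_gt 2 _).
Qed.

Lemma bit_rel_closed N r x y : x < N -> bit_rel N r x y -> y < N.
Proof. by move=> _ /and3P[]. Qed.

Lemma frame_checkP N r a :
  frame_check N r (godel a) <-> valid [set x | x < N] (bit_rel N r) a.
Proof.
split=> [/ballP h V x /= xN|h]; last first.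
  apply/ballP => v _; apply/ballP => w wN; apply/checkP => //; exact: h.
(* The bit at place [p * N + w] records whether variable [p] holds at [w]. *)
have [v vM hv] := bits_ex (fun i => `[< V (i %/ N) (i %% N) >]) ((godel a).+1 * N).
have /ballP/(_ x xN)/checkP-/(_ xN) hs := h v vM.
apply: (proj1 (sat_maxvar (@bit_rel_closed N r) (maxvar_godel a) _ xN)) hs.
move=> p y pm /= yN; rewrite /bit_val hv.
  by rewrite divnMDl ?(leq_trans _ yN)// divn_small// addn0 modnMDl modn_small// asboolE.
by apply: leq_trans (leq_mul pm (leqnn N)); rewrite mulSn addnC ltn_add2r.
Qed.

Lemma bit_rel_ex N (R : rel nat) : (forall x y, R x y -> x < N /\ y < N) ->
  exists2 r, r < 2 ^ (N * N) & bit_rel N r = R.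
Proof.
move=> RN; have [r rM hr] := bits_ex (fun i => R (i %/ N) (i %% N)) (N * N).
exists r => //; apply/funext => x; apply/funext => y; rewrite /bit_rel.
have [xN|xN] := ltnP x N; last first.
  by apply/esym/negP => /RN[]; rewrite ltnNge xN.
have [yN|yN] := ltnP y N; last first.
  by apply/esym/negP => /RN[_]; rewrite ltnNge yN.
rewrite hr /=.
  by rewrite divnMDl ?(leq_trans _ yN)// divn_small// addn0 modnMDl modn_small.
by apply: leq_trans (leq_mul xN (leqnn N)); rewrite mulSn addnC ltn_add2r.
Qed.

Lemma rec_truth_row N r v c t : recursive N -> recursive r -> recursive v ->
  recursive c -> recursive t ->
  recursive (fun e => truth_row (N e) (r e) (v e) (c e) (t e)).
Proof.
move=> rN rr rv rc rt; apply: rec_ptab => //.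
apply: rec_if; first by apply: rec_eqc; rec_basic.
  apply: rec_bit; rec_basic; apply: rec_add; rec_basic.
  by apply: rec_mul; rec_basic.
apply: rec_if; first by apply: rec_eqc; rec_basic.
  exact: rec_const.
apply: rec_if; first by apply: rec_eqc; rec_basic.
  by apply: rec_imp; apply: rec_nonzero; apply: rec_get; rec_basic;
    apply: rec_get; rec_basic.
apply: rec_ball; rec_basic; apply: rec_imp.
  apply: rec_bit; rec_basic; apply: rec_add; rec_basic.
  by apply: rec_mul; rec_basic.
by apply: rec_nonzero; apply: rec_get; rec_basic; apply: rec_get; rec_basic.
Qed.

Lemma rec_check N r v c w : recursive N -> recursive r -> recursive v ->
  recursive c -> recursive w ->
  recursive (fun e => nat_of_bool (check (N e) (r e) (v e) (c e) (w e))).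
Proof.
move=> rN rr rv rc rw; apply: rec_nonzero; apply: rec_get => //.
apply: rec_truth_row => //; apply: rec_ptab => //.
by apply: rec_truth_row; rec_basic.
Qed.

Lemma rec_frame_check N r c : recursive N -> recursive r -> recursive c ->
  recursive (fun e => nat_of_bool (frame_check (N e) (r e) (c e))).
Proof.
move=> rN rr rc; apply: rec_ball.
  by apply: rec_pow2; apply: rec_mul; rec_basic.
by apply: rec_ball; rec_basic; apply: rec_check; rec_basic.
Qed.

Lemma rec_mtype_card f d : recursive f -> recursive (fun e => mtype_card (f e) d).
Proof.
move=> rf; elim: d => [|d IH] /=; first exact: rec_const.
apply: rec_mul; last exact: rec_pow2.
by apply: rec_mul; [|apply: rec_pow2]; apply: rec_pow2.
Qed.

(** A non-theorem fails in a frame of bounded size that validates the axioms, so it suffices to test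
    all relations on boundedly many worlds. *)
Theorem finite_axioms_decidable (n : nat) (D : seq form) : 0 < n ->
  List.In ax4 D -> List.In (axB n) D ->
  decidable_set (oplus logicK [set b | List.In b D]).
Proof.
move=> n0 D4 DB; set L := oplus _ _.
have hL : modal_logic L by apply: smallest_modal_logic.
have DL b : List.In b D -> L b by move=> bD; apply: oplus_ax.
pose axs N r := all (fun b => frame_check N r (godel b)) D.
have axsP N r : axs N r <-> forall b, List.In b D -> valid [set x | x < N] (bit_rel N r) b.
  rewrite /axs; elim: D {D4 DB L hL DL axs} => [|b D IH] //=.
  split=> [/andP[/frame_checkP hb /IH hD] c [<-//|]|h]; first exact: hD.
  by apply/andP; split; [apply/frame_checkP/h; left|apply/IH => c cD; apply: h; right].
(* A formula with code [c] has its variables below [c.+1], whence the bound; the outer [.+1] admits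
   frames that attain it. *)
exists (fun c => nat_of_bool (ball (mtype_card c.+1 n).+1 (fun N =>
    ball (2 ^ (N * N)) (fun r => axs N r ==> frame_check N r c)))).
  apply: rec_ball; first by rec_basic; apply: rec_mtype_card; rec_basic.
  apply: rec_ball; first by apply: rec_pow2; apply: rec_mul; rec_basic.
  apply: rec_imp; last by apply: rec_frame_check; rec_basic.
  (* [D] is fixed, so testing the axioms is a finite conjunction of recursive tests. *)
  rewrite /axs; elim: (D) => [|b D' IH] /=; first exact: rec_const.
  by apply: rec_and => //; apply: rec_frame_check; rec_basic.
move=> a; split=> [La|nLa].
  suff -> : ball (mtype_card (godel a).+1 n).+1 (fun N => ball (2 ^ (N * N))
    (fun r => axs N r ==> frame_check N r (godel a))) by [].
  apply/ballP => N _; apply/ballP => r _; apply/implyP => /axsP h.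
  apply/frame_checkP; apply: (oplusK_sub _ h) La.
  exact: valid_modal_logic (@bit_rel_closed N r).
have [N [R [NM RN LV nVa]]] :=
  finite_model_property hL (DL _ D4) n0 (DL _ DB) nLa (maxvar_godel a).
have [r rM rR] := bit_rel_ex RN.
case: ballP => // h; case: nVa; rewrite -rR; apply/frame_checkP.
have /ballP/(_ r rM)/implyP := h N NM; apply; apply/axsP => b bD.
by rewrite rR; apply: LV; apply: DL.
Qed.

Lemma finite_set_In (T : Type) (l : seq T) : finite_set [set x | List.In x l].
Proof.
elim: l => [|y l IH] /=.
  by rewrite (_ : [set _ | False] = set0)//; apply/seteqP; split.
rewrite (_ : [set x | _] = [set y] `|` [set x | List.In x l]).
  by rewrite finite_setU; split.
by apply/seteqP; split=> x /= [->|]; auto.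
Qed.

Unset Implicit Arguments.

Theorem theorem4p12 (n k : nat) (hn : 1 <= n) (hk : 1 <= k) (L : set form)
    (hL : extension_of
            (oplus (logicK4B n) [set axWidPlus 1; axWidBullet k]) L) :
  finitely_axiomatizable L /\ decidable_set L.
Proof.
have [D [baseD ->]] :=
  extension_finitely_axiomatized hn (proj1 hL) (extension_base hL).
split; first by exists [set b | List.In b D]; split=> //; apply: finite_set_In.
by apply: (finite_axioms_decidable hn); apply: baseD => /=; auto.
Qed.
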